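(* Let $A_1,\dots,A_L$ be compact self-adjoint operators in a Hilbert space such that for some $p>0$ $$A_\ell A_j\in\mathbf S^0_{p/2,\infty}\quad\text{for all }\ell\ne j.$$ Then for $A=A_1+\dots+A_L$ and for each choice of the sign $\pm$, $$\Delta_p^\pm(A)\le\sum_{\ell=1}^L\Delta_p^\pm(A_\ell),\qquad\delta_p^\pm(A)\ge\sum_{\ell=1}^L\delta_p^\pm(A_\ell).$$ In particular, if $\Delta_p^\pm(A_\ell)=\delta_p^\pm(A_\ell)$ for all $\ell$, then $$\Delta_p^\pm(A)=\delta_p^\pm(A)=\sum_{\ell=1}^L\Delta_p^\pm(A_\ell).$$
   Context: For a compact self-adjoint operator $A$, $\{\lambda_n^+(A)\}_{n\ge1}$ is the non-increasing sequence of positive eigenvalues of $A$, counted with multiplicities and appended by zeros if there are only finitely many; $\lambda_n^-(A)=\lambda_n^+(-A)$. For a compact operator $A$, $s_n(A)=\lambda_n^+(|A|)$, $|A|=\sqrt{A^*A}$, are the singular values. For $p>0$: $\Delta_p^\pm(A)=\limsup_{n\to\infty}n\lambda_n^\pm(A)^p$ and $\delta_p^\pm(A)=\liminf_{n\to\infty}n\lambda_n^\pm(A)^p$ (for $A$ compact self-adjoint), with values in $[0,\infty]$. For $q>0$, $\mathbf S^0_{q,\infty}$ is the class of compact operators $A$ with $\lim_{n\to\infty}ns_n(A)^q=0$. *)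

(* Defs.v *)
From HB Require Import structures.
From mathcomp Require Import all_boot all_order all_algebra.
From mathcomp Require Import sesquilinear complex.
From mathcomp Require Import all_classical all_reals all_analysis.

Set Implicit Arguments.
Unset Strict Implicit.
Unset Printing Implicit Defensive.

Import Order.TTheory GRing.Theory Num.Theory.
Import numFieldNormedType.Exports.

Local Open Scope classical_set_scope.
Local Open Scope ring_scope.

(* A complex Hilbert space is a complete normed space [H] over [R[i]] together
   with an inner product [dot] (linear in the first argument) such that
   [hilbert_dot dot] holds. Operators are plain functions [H -> H]; linearity
   and boundedness are part of the predicates below. *)
Section Operators.
Variables (R : realType) (H : completeNormedModType R[i]).
Variable dot : {dot H for Num.conj}.
Implicit Types A B T : H -> H.

Definition hilbert_dot : Prop := forall x : H, dot x x = `|x| ^+ 2.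

Definition bounded_op A : Prop := linear A /\ continuous A.

Definition compact_op A : Prop :=
  linear A /\ precompact (A @` [set x : H | `|x| <= 1]).

Definition is_adjoint A B : Prop := forall x y : H, dot (A x) y = dot x (B y).

Definition selfadjoint A : Prop := is_adjoint A A.

Definition adjoint A : H -> H := xget (fun=> 0) [set B | is_adjoint A B].

(* [0 <= z] in [R[i]] says that [z] is real and non-negative. *)
Definition positive_op A : Prop := forall x : H, 0 <= dot (A x) x.

Definition sqrt_op B : H -> H :=
  xget (fun=> 0)
    [set T | [/\ bounded_op T, selfadjoint T, positive_op T & T \o T = B]].

Definition abs_op A : H -> H := sqrt_op (adjoint A \o A).

Definition eigenspace_op A (mu : R) : set H := [set x | A x = mu%:C%C *: x].

Definition is_basis (E : set H) (d : nat) (e : 'I_d -> H) : Prop :=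
  [/\ forall i, E (e i),
      forall c : 'I_d -> R[i], \sum_(i < d) c i *: e i = 0 -> forall i, c i = 0
    & forall x, E x -> exists c : 'I_d -> R[i], x = \sum_(i < d) c i *: e i].

Definition has_dim (E : set H) (d : nat) : Prop :=
  exists e : 'I_d -> H, is_basis E e.

(* [l] lists the positive eigenvalues in non-increasing order, each [mu > 0]
   occurring exactly dim ker (A - mu) times (zero times if it is not an
   eigenvalue); the remaining terms, if any, are 0. *)
Definition is_pos_eigenseq A (l : nat -> R) : Prop :=
  [/\ forall n, 0 <= l n,
      forall m n, (m <= n)%N -> l n <= l m
    & forall mu : R, 0 < mu ->
        exists2 d : nat, has_dim (eigenspace_op A mu) d
                       & ([set n | l n = mu] #= `I_d)%card].

(* Sequences are indexed from 0: [lambda_plus A n] is the (n+1)-st positive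
   eigenvalue, whence the factors [n.+1] below. *)
Definition lambda_plus A : nat -> R :=
  xget (fun=> 0) [set l | is_pos_eigenseq A l].

Definition lambda_minus A : nat -> R := lambda_plus (fun x => - A x).

Definition singular_value A : nat -> R := lambda_plus (abs_op A).

(* [true] is the sign +, [false] the sign -. *)
Definition lambda (s : bool) A : nat -> R :=
  if s then lambda_plus A else lambda_minus A.

Definition Delta (p : R) (s : bool) A : \bar R :=
  limn_esup (fun n => (n.+1%:R * lambda s A n `^ p)%:E).

Definition delta (p : R) (s : bool) A : \bar R :=
  limn_einf (fun n => (n.+1%:R * lambda s A n `^ p)%:E).

Definition S0_class (q : R) A : Prop :=
  compact_op A /\
  (n.+1%:R * singular_value A n `^ q : R) @[n --> \oo] --> (0 : R).

End Operators.

(* Main.v *)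
Require Import Defs.
From HB Require Import structures.
From mathcomp Require Import all_boot all_order all_algebra.
From mathcomp Require Import sesquilinear complex.
From mathcomp Require Import all_classical all_reals all_analysis.
From mathcomp Require Import ring lra.

(** Everything rests on the variational description of the positive eigenvalues
    of a compact self-adjoint operator: there are orthonormal eigenvectors
    [e_0, e_1, ...] such that [<A x, x> <= lambda_n |x|^2] whenever [x] is
    orthogonal to [e_0, ..., e_(n-1)].

    Write [A = A_1 + ... + A_L] and [x_l = A_l y_l]. Off a subspace of dimension
    [m L^2] one has [|A_k A_l y| <= s_m (A_k A_l) |y|] for all [k != l], so by
    self-adjointness every cross term [<x_l, x_j>] and [<A_k x_l, x_j>] (indices
    not all equal) is small; hence [|x|^2] and [<A x, x>], where
    [x = x_1 + ... + x_L], are close to [sum |x_l|^2] and [sum <A_l x_l, x_l>].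
    - Lower bound: let [y_l] range over the span of [n_l] eigenvectors of [A_l]
      with eigenvalue at least [t]; if [N + m L^3 < sum n_l], some nonzero
      choice makes [x] orthogonal to the first [N] eigenvectors of [A], which
      forces [lambda_N (A)] to be almost at least [t].
    - Upper bound: let all [y_l] equal the same [y] in the span of [N + 1]
      eigenvectors of [A] with eigenvalue at least [t], so that [x = A y]; if
      [N = sum n_l + m L^2], some nonzero [y] is orthogonal to the first [n_l]
      eigenvectors of each [A_l], so that [t] is almost at most
      [max_l lambda_(n_l) (A_l)].
    With [n_l] and [m] proportional to [t^(-p)], and [m] negligible because
    [A_k A_l] lies in [S^0_(p/2,oo)], these are the two inequalities. *)

Set Implicit Arguments.
Unset Strict Implicit.
Unset Printing Implicit Defensive.

Import Order.TTheory GRing.Theory Num.Theory.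
Import numFieldNormedType.Exports.

Local Open Scope classical_set_scope.
Local Open Scope ring_scope.

(** * The real-valued norm and inner product *)

Section RealNorm.
Variables (R : realType) (V : normedModType R[i]).
Implicit Types (x y : V) (a : R).

Definition rnorm x : R := complex.Re `|x|.

Lemma norm_rnormE x : `|x| = (rnorm x)%:C%C.
Proof. by rewrite /rnorm RRe_real ?normr_real. Qed.

Lemma rnorm_ge0 x : 0 <= rnorm x.
Proof. by rewrite -ler0c -norm_rnormE. Qed.

Lemma rnorm0 : rnorm 0 = 0.
Proof. by rewrite /rnorm normr0. Qed.

Lemma rnorm_eq0 x : (rnorm x == 0) = (x == 0).
Proof. by rewrite -[RHS]normr_eq0 norm_rnormE -(inj_eq (@complexI R)). Qed.

Lemma rnorm_gt0 x : (0 < rnorm x) = (x != 0).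
Proof. by rewrite lt_neqAle rnorm_ge0 andbT eq_sym rnorm_eq0. Qed.

Lemma rnormN x : rnorm (- x) = rnorm x.
Proof. by rewrite /rnorm normrN. Qed.

Lemma rnormD_le x y : rnorm (x + y) <= rnorm x + rnorm y.
Proof. by rewrite -lecR rmorphD /= -!norm_rnormE ler_normD. Qed.

Lemma rnorm_dist_le x y z : rnorm (x - z) <= rnorm (x - y) + rnorm (z - y).
Proof.
have := rnormD_le (x - y) (y - z).
by rewrite subrKA -(rnormN (y - z)) opprB.
Qed.

Lemma rnorm_le_sqr x a : 0 <= a -> (rnorm x <= a) = (rnorm x ^+ 2 <= a ^+ 2).
Proof. by move=> a0; rewrite ler_pXn2r ?nnegrE ?rnorm_ge0. Qed.

Lemma rnormZ a x : rnorm (a%:C%C *: x) = `|a| * rnorm x.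
Proof.
apply: (@complexI R); rewrite rmorphM -norm_rnormE normrZ norm_rnormE.
by congr (_ * _); rewrite normc_def /= expr0n /= addr0 sqrtr_sqr.
Qed.

Lemma rnorm_normalize x : x != 0 -> rnorm ((rnorm x)^-1%:C%C *: x) = 1.
Proof.
by rewrite -rnorm_gt0 => x0; rewrite rnormZ gtr0_norm ?invr_gt0// mulVf ?gt_eqF.
Qed.

Lemma gt0_complexE (c : R[i]) : 0 < c -> exists2 a : R, 0 < a & c = a%:C%C.
Proof.
move=> c0; have cE := RRe_real (gtr0_real c0).
by exists (complex.Re c); rewrite ?cE// -ltcR cE.
Qed.

Lemma cvg_rnormP (T : Type) (F : set_system T) {FF : Filter F} (f : T -> V) x :
  f t @[t --> F] --> x <-> rnorm (f t - x) @[t --> F] --> (0 : R).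
Proof.
split=> [/cvgrPdist_lt fx|/cvgr0Pnorm_lt fx].
  apply/cvgr0Pnorm_lt => e e0; have e0C : 0 < e%:C%C by rewrite ltcR.
  move: (fx _ e0C); apply: filterS => t.
  by rewrite distrC norm_rnormE ltcR ger0_norm ?rnorm_ge0.
apply/cvgrPdist_lt => _ /gt0_complexE[e e0 ->].
move: (fx _ e0); apply: filterS => t.
by rewrite ger0_norm ?rnorm_ge0// distrC norm_rnormE ltcR.
Qed.

Lemma cvg_near_rnorm_lt (T : Type) (F : set_system T) {FF : Filter F}
    (f : T -> V) x (e : R) : 0 < e -> f t @[t --> F] --> x ->
  \forall t \near F, rnorm (f t - x) < e.
Proof.
move=> e0 /cvg_rnormP/cvgr0_norm_lt/(_ e e0); apply: filterS => t.
by rewrite ger0_norm ?rnorm_ge0.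
Qed.

Lemma rnorm_cvg (T : Type) (F : set_system T) {FF : Filter F} (f : T -> V) x :
  f t @[t --> F] --> x -> rnorm (f t) @[t --> F] --> rnorm x.
Proof.
move=> fx; apply/cvgrPdist_lt => e e0.
apply: filterS (cvg_near_rnorm_lt e0 fx) => t; apply: le_lt_trans.
have := rnorm_dist_le (f t) x 0; have := rnorm_dist_le x (f t) 0.
rewrite !subr0 !sub0r !rnormN -(rnormN (x - _)) opprB ler_norml; lra.
Qed.

Lemma rnorm_sqr_cvg0 (T : Type) (F : set_system T) {FF : Filter F}
    (f : T -> V) :
  rnorm (f t) ^+ 2 @[t --> F] --> (0 : R) -> f t @[t --> F] --> 0.
Proof.
move=> /cvg_comp/(_ (@sqrt_continuous R 0)); rewrite sqrtr0 => f0.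
apply/cvg_rnormP.
under eq_fun do rewrite subr0 -[rnorm _]ger0_norm ?rnorm_ge0//.
by under eq_fun do rewrite -sqrtr_sqr.
Qed.

End RealNorm.

Definition linear_pack (K : pzRingType) (V W : lmodType K) (f : V -> W)
    (lf : linear f) : {linear V -> W} :=
  HB.pack f (GRing.isLinear.Build K V W *:%R f lf).

Section ContinuousLinear.
Variables (R : realType) (V W : normedModType R[i]).
Implicit Type A : {linear V -> W}.

Lemma linear_continuousP A : continuous A <->
  exists2 K : R, 0 < K & forall x, rnorm (A x) <= K * rnorm x.
Proof.
have le_rnorm (K : R) x :
    (`|A x| <= K%:C%C * `|x|) = (rnorm (A x) <= K * rnorm x).
  by rewrite !norm_rnormE -rmorphM lecR.
rewrite -linear_bounded_continuous linear_boundedP; split.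
  move=> /pinfty_ex_gt0[_ /gt0_complexE[K K0 ->] AK].
  by exists K => // x; rewrite -le_rnorm.
move=> [K K0 AK]; exists K%:C%C; split; first by rewrite gtr0_real// ltcR.
move=> c Kc x; apply: le_trans (_ : K%:C%C * `|x| <= _).
  by rewrite le_rnorm.
by rewrite ler_wpM2r// ltW.
Qed.

End ContinuousLinear.

Lemma quadratic_ge0_discriminant (R : rcfType) (a b c : R) :
  (forall s, 0 <= a + 2 * b * s + c * s ^+ 2) -> b ^+ 2 <= a * c.
Proof.
move=> pos; have := @deg_le2_poly_ge0 R (Poly [:: a; 2 * b; c]) (size_Poly _).
rewrite !coef_Poly => disc; suff : (2 * b) ^+ 2 - 4 * c * a <= 0 by lra.
apply: disc => s; rewrite horner_Poly /= mul0r add0r.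
by rewrite (_ : _ + a = a + 2 * b * s + c * s ^+ 2)//; ring.
Qed.

Section RealInnerProduct.
Variables (R : realType) (H : completeNormedModType R[i]).
Variable dot : {dot H for Num.conj}.
Implicit Types (x y z : H) (a : R).

Definition rdot x y : R := complex.Re (dot x y).

Lemma dotC x y : dot x y = (dot y x)^*.
Proof. by rewrite hermC expr0 mul1r. Qed.

Lemma dotZl (c : R[i]) x y : dot (c *: x) y = c * dot x y.
Proof. exact: linearZl_LR. Qed.

Lemma dotZr (c : R[i]) x y : dot x (c *: y) = c^* * dot x y.
Proof. exact: linearZr_LR. Qed.

Lemma dotZr_real a x y : dot x (a%:C%C *: y) = a%:C%C * dot x y.
Proof. by rewrite dotZr conj_Creal// complex_real. Qed.

Lemma rdotC x y : rdot x y = rdot y x.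
Proof. by rewrite /rdot dotC; case: (dot y x). Qed.

Lemma rdotDl x y z : rdot (x + y) z = rdot x z + rdot y z.
Proof.
by rewrite /rdot linearDl (raddfD (@complex.Re R : Rcomplex R -> R)).
Qed.

Lemma rdotZl a x y : rdot (a%:C%C *: x) y = a * rdot x y.
Proof.
by rewrite /rdot dotZl; case: (dot x y) => ? ? /=; rewrite mul0r subr0.
Qed.

Lemma rdot_suml (I : Type) (r : seq I) (P : pred I) (F : I -> H) z :
  rdot (\sum_(i <- r | P i) F i) z = \sum_(i <- r | P i) rdot (F i) z.
Proof.
by rewrite /rdot linear_sumlz (raddf_sum (@complex.Re R : Rcomplex R -> R)).
Qed.

Lemma rdotNl x y : rdot (- x) y = - rdot x y.
Proof. by rewrite -scaleN1r -(rmorphN1 (@real_complex R)) rdotZl mulN1r. Qed.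

Lemma rdotBl x y z : rdot (x - y) z = rdot x z - rdot y z.
Proof. by rewrite rdotDl rdotNl. Qed.

Lemma rdot0l y : rdot 0 y = 0.
Proof. by rewrite -(subrr y) rdotBl subrr. Qed.

Lemma rdotDr x y z : rdot z (x + y) = rdot z x + rdot z y.
Proof. by rewrite !(rdotC z) rdotDl. Qed.

Lemma rdotZr a x y : rdot x (a%:C%C *: y) = a * rdot x y.
Proof. by rewrite !(rdotC x) rdotZl. Qed.

Lemma rdotBr x y z : rdot z (x - y) = rdot z x - rdot z y.
Proof. by rewrite !(rdotC z) rdotBl. Qed.

Lemma rdot_sumr (I : Type) (r : seq I) (P : pred I) (F : I -> H) z :
  rdot z (\sum_(i <- r | P i) F i) = \sum_(i <- r | P i) rdot z (F i).
Proof. by rewrite rdotC rdot_suml; apply: eq_bigr => i _; rewrite rdotC. Qed.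

Lemma selfadjoint_rdot (T : H -> H) : selfadjoint dot T ->
  forall x y, rdot (T x) y = rdot x (T y).
Proof. by move=> saT x y; rewrite /rdot saT. Qed.

Lemma selfadjoint_formE (T : H -> H) x : selfadjoint dot T ->
  dot (T x) x = (rdot (T x) x)%:C%C.
Proof. by move=> saT; rewrite RRe_real// CrealE -dotC saT. Qed.

Lemma positive_op_rdot_ge0 (T : H -> H) x :
  positive_op dot T -> 0 <= rdot (T x) x.
Proof. by move=> /(_ x); rewrite lecE => /andP[]. Qed.

Definition subspace (F : set H) :=
  F 0 /\ forall (c : R[i]) x y, F x -> F y -> F (c *: x + y).

Lemma subspaceD (F : set H) x y : subspace F -> F x -> F y -> F (x + y).
Proof. by move=> [_ linF] Fx Fy; rewrite -(scale1r x); exact: linF. Qed.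

Lemma subspaceZ (F : set H) (c : R[i]) x : subspace F -> F x -> F (c *: x).
Proof. by move=> [F0 linF] Fx; rewrite -(addr0 (c *: x)); exact: linF. Qed.

Section PositiveForm.
Variables (T : {linear H -> H}) (F : set H).
Hypotheses (saT : selfadjoint dot T) (subF : subspace F).
Hypothesis T_ge0 : forall x, F x -> 0 <= rdot (T x) x.

Lemma positive_CauchySchwarz x y : F x -> F y ->
  rdot (T x) y ^+ 2 <= rdot (T x) x * rdot (T y) y.
Proof.
move=> Fx Fy; apply: quadratic_ge0_discriminant => s.
have := T_ge0 (subspaceD subF Fx (subspaceZ s%:C%C subF Fy)).
rewrite linearD linearZ /= !rdotDl !rdotDr !rdotZl !rdotZr.
rewrite (selfadjoint_rdot saT y) (rdotC y); congr (_ <= _); ring.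
Qed.

End PositiveForm.

Hypothesis dotE : hilbert_dot dot.

Lemma dotxx x : dot x x = (rnorm x ^+ 2)%:C%C.
Proof. by rewrite dotE norm_rnormE rmorphXn. Qed.

Lemma rdotxx x : rdot x x = rnorm x ^+ 2.
Proof. by rewrite /rdot dotxx. Qed.

Lemma rnorm_sqrB x y :
  rnorm (x - y) ^+ 2 = rnorm x ^+ 2 - 2 * rdot x y + rnorm y ^+ 2.
Proof. by rewrite -!rdotxx rdotBl !rdotBr (rdotC y x); ring. Qed.

Lemma rdot_CauchySchwarz x y : `|rdot x y| <= rnorm x * rnorm y.
Proof.
rewrite -(ler_pXn2r (n := 2))// ?nnegrE ?mulr_ge0 ?rnorm_ge0//.
rewrite real_normK ?num_real// exprMn -!rdotxx.
apply: (@positive_CauchySchwarz idfun setT) => // u _.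
by rewrite rdotxx sqr_ge0.
Qed.

Lemma rdot_le x y : rdot x y <= rnorm x * rnorm y.
Proof. exact: le_trans (ler_norm _) (rdot_CauchySchwarz x y). Qed.

(* [|<x, y>|^2] is the real inner product of [x] and [<x, y> y]. *)
Lemma dot_CauchySchwarz x y :
  rnorm (dot x y : R[i]^o) <= rnorm x * rnorm y.
Proof.
set c := dot x y; have [->|c0] := eqVneq c 0.
  by rewrite rnorm0 mulr_ge0 ?rnorm_ge0.
have sqrc : rnorm (c : R[i]^o) ^+ 2 = rdot x (c *: y).
  apply: (@complexI R); rewrite rmorphXn /= -norm_rnormE /rdot dotZr normCKC.
  by rewrite RRe_real// -normCKC rpredX// normr_real.
have normc : rnorm (c *: y) = rnorm (c : R[i]^o) * rnorm y.
  by apply: (@complexI R); rewrite rmorphM /= -!norm_rnormE normrZ.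
rewrite -(ler_pM2l (_ : 0 < rnorm (c : R[i]^o))) ?rnorm_gt0// -expr2 sqrc.
by rewrite (le_trans (rdot_le _ _))// normc mulrCA.
Qed.

Lemma dot_cvgl (T : Type) (F : set_system T) {FF : Filter F} (f : T -> H) x y :
  f t @[t --> F] --> x -> dot (f t) y @[t --> F] --> (dot x y : R[i]^o).
Proof.
move=> /cvg_rnormP fx; apply/cvg_rnormP.
apply: (squeeze_cvgr (f := cst 0) (h := fun t => rnorm (f t - x) * rnorm y)).
- near=> t; rewrite rnorm_ge0/= -linearBl; exact: dot_CauchySchwarz.
- exact: cvg_cst.
by rewrite -[X in _ --> X](mul0r (rnorm y)); apply: cvgMr_tmp.
Unshelve. all: by end_near. Qed.

Lemma dot_cvgr (T : Type) (F : set_system T) {FF : Filter F} (f : T -> H) x y :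
  f t @[t --> F] --> x -> dot y (f t) @[t --> F] --> (dot y x : R[i]^o).
Proof.
move=> /(@dot_cvgl _ _ _ _ _ y)/cvg_rnormP fx; apply/cvg_rnormP.
rewrite (_ : (fun t => _) = fun t => rnorm (dot (f t) y - dot x y : R[i]^o))//.
apply/funext => t; rewrite (dotC y (f t)) (dotC y x) -rmorphB.
by rewrite /rnorm norm_conjC.
Qed.

Lemma dot_limE (f : nat -> H) x y (c : R[i]) : f n @[n --> \oo] --> x ->
  dot (f n) y @[n --> \oo] --> (c : R[i]^o) -> dot x y = c.
Proof. by move=> fx; exact: norm_cvg_unique (dot_cvgl fx). Qed.

Lemma rdot_cvgl (T : Type) (F : set_system T) {FF : Filter F} (f : T -> H) x y :
  f t @[t --> F] --> x -> rdot (f t) y @[t --> F] --> rdot x y.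
Proof.
move=> fx; apply/cvgrPdist_lt => e e0.
have y1 : 0 < rnorm y + 1 by rewrite ltr_wpDl ?rnorm_ge0.
apply: filterS (cvg_near_rnorm_lt (divr_gt0 e0 y1) fx) => t.
rewrite distrC -rdotBl ltr_pdivlMr//; apply: le_lt_trans.
apply: le_trans (rdot_CauchySchwarz _ _) _.
by rewrite ler_wpM2l ?rnorm_ge0// lerDl.
Qed.

(* Cauchy-Schwarz for the form of [T] applied to [x] and [T x]. *)
Lemma rnorm_sqr_le_form (T : {linear H -> H}) (F : set H) (K : R) :
  selfadjoint dot T -> subspace F -> (forall x, F x -> F (T x)) ->
  (forall x, F x -> 0 <= rdot (T x) x <= K * rnorm x ^+ 2) ->
  forall x, F x -> rnorm (T x) ^+ 2 <= K * rdot (T x) x.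
Proof.
move=> saT subF FT formT x Fx; have [->|Tx0] := eqVneq (T x) 0.
  by rewrite rdot0l rnorm0 expr0n mulr0.
have T_ge0 z Fz := proj1 (andP (formT z Fz)).
have /andP[_ TTx] := formT _ (FT _ Fx).
have Tx2 : 0 < rnorm (T x) ^+ 2 by rewrite exprn_gt0 ?rnorm_gt0.
rewrite -(ler_pM2r Tx2) -expr2 -{1}rdotxx mulrAC [leRHS]mulrC.
apply: le_trans (positive_CauchySchwarz saT subF T_ge0 Fx (FT _ Fx)) _.
by rewrite ler_wpM2l// T_ge0.
Qed.

End RealInnerProduct.

Section Orthogonal.
Variables (R : realType) (H : completeNormedModType R[i]).
Variable dot : {dot H for Num.conj}.

Definition orth (I : Type) (v : I -> H) : set H :=
  [set x | forall i, dot x (v i) = 0].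

Lemma subspace_orth (I : Type) (v : I -> H) : subspace (orth v).
Proof.
split=> [i|c x y ox oy i]; first exact: linear0l.
by rewrite linearDl /= dotZl ox oy mulr0 addr0.
Qed.

Lemma closed_orth (I : Type) (v : I -> H) : hilbert_dot dot -> closed (orth v).
Proof.
move=> dotE; have -> : orth v = \bigcap_i (dot^~ (v i) @^-1` [set 0]).
  by apply/seteqP; split=> [x ox i _|x ox i]; exact: ox.
apply: closed_bigI => i _; apply: preimage_closed => [x _|].
  exact: (dot_cvgl dotE).
exact/(@accessible_closed_set1 R[i]^o)/hausdorff_accessible/norm_hausdorff.
Qed.

Lemma orth_eigenvectors (I : Type) (v : I -> H) (T : H -> H) :
  selfadjoint dot T -> (forall i, exists l : R, T (v i) = l%:C%C *: v i) ->
  forall x, orth v x -> orth v (T x).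
Proof.
move=> saT eigv x ox i; rewrite saT; have [l ->] := eigv i.
by rewrite dotZr ox mulr0.
Qed.

End Orthogonal.

(** * Compact operators *)

Section SequentialCompactness.
Variables (R : realType) (V W : normedModType R[i]).

Definition seq_compact (A : V -> W) := forall u : nat -> V,
  (forall n, rnorm (u n) <= 1) ->
  exists2 s : nat -> nat, s @ \oo --> \oo & cvgn (A \o u \o s).

Lemma leq_cvgny (s : nat -> nat) : (forall n, (n <= s n)%N) -> s @ \oo --> \oo.
Proof.
move=> les; apply/cvgnyPge => N; near=> n; apply: leq_trans (les n).
by near: n; exact: nbhs_infty_ge.
Unshelve. all: by end_near. Qed.

Lemma precompact_seq_compact (A : V -> W) :
  precompact (A @` [set x | `|x| <= 1]) -> seq_compact A.
Proof.
rewrite precompactE => cA u u1; have [|y [_ clus]] := cA ((A \o u) @ \oo) _.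
  exists 0%N => // n _; apply: subset_closure.
  by exists (u n) => //=; rewrite norm_rnormE -[1]/(1%:C)%C lecR.
have /choice[s sP] : forall k, exists n,
    (k <= n)%N /\ rnorm (A (u n) - y) < harmonic k.
  move=> k.
  have [||z [[n kn <-] Auny]] := clus ((A \o u) @` [set n | (k <= n)%N])
      [set z | rnorm (z - y) < harmonic k].
  - by exists k => // n kn; exists n.
  - by apply: cvg_near_rnorm_lt; [exact: harmonic_gt0|exact: cvg_id].
  by exists n.
exists s; first by apply: leq_cvgny => n; case: (sP n).
apply/cvg_ex; exists y; apply/cvg_rnormP.
apply: (squeeze_cvgr (f := cst 0) (h := harmonic)) => //.
- by apply: nearW => n; rewrite rnorm_ge0 ltW//; case: (sP n).
- exact: cvg_cst.
exact: cvg_harmonic.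
Qed.

Lemma seq_compact_bounded_ball (A : V -> W) : seq_compact A ->
  exists K : nat, forall x, rnorm x <= 1 -> rnorm (A x) <= K%:R.
Proof.
move=> cA; apply/not_existsP => unbounded.
have /choice[u uP] : forall n, exists x, rnorm x <= 1 /\ n%:R < rnorm (A x).
  move=> n; have /existsNP[x /not_implyP[x1 /negP]] := unbounded n.
  by rewrite -ltNge; exists x.
have [n|s soo /cvg_ex[y /rnorm_cvg Ausy]] := cA u; first by case: (uP n).
pose N := Num.bound (rnorm y + 1).
have /filter_ex[n [Auy leNs]] : \forall n \near \oo,
    rnorm (A (u (s n))) < rnorm y + 1 /\ (N <= s n)%N.
  apply: filterI; first by apply: cvgr_lt Ausy _ _; rewrite ltrDl.
  by move/cvgnyPge: soo; exact.
have [_] := uP (s n); apply/negP; rewrite -leNgt; apply/ltW/(lt_trans Auy).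
apply: lt_le_trans (archi_boundP _) _; first by rewrite addr_ge0 ?rnorm_ge0.
by rewrite ler_nat.
Qed.

Lemma seq_compact_bounded (A : {linear V -> W}) : seq_compact A ->
  exists2 K : R, 0 < K & forall x, rnorm (A x) <= K * rnorm x.
Proof.
move=> /seq_compact_bounded_ball[K bK].
exists (K%:R + 1) => [|x]; first by rewrite ltr_wpDl.
have [->|x0] := eqVneq x 0; first by rewrite linear0 !rnorm0 mulr0.
have xE : x = (rnorm x)%:C%C *: ((rnorm x)^-1%:C%C *: x).
  by rewrite scalerA -rmorphM mulfV ?scale1r// rnorm_eq0.
rewrite {1}xE linearZ rnormZ ger0_norm ?rnorm_ge0// mulrC.
rewrite ler_wpM2r ?rnorm_ge0//; apply: le_trans (bK _ _) _.
  by rewrite rnorm_normalize.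
by rewrite lerDl.
Qed.

Lemma seq_compact_continuous (A : {linear V -> W}) :
  seq_compact A -> continuous A.
Proof. by move=> /seq_compact_bounded bA; apply/linear_continuousP. Qed.

Lemma seq_compactN (A : V -> W) : seq_compact A -> seq_compact (fun x => - A x).
Proof. by move=> cA u /cA[s soo Aus]; exists s => //; exact: is_cvgN. Qed.

Lemma seq_compactD (A B : V -> W) :
  seq_compact A -> seq_compact B -> seq_compact (fun x => A x + B x).
Proof.
move=> cA cB u u1; have [s soo /cvg_ex[y Ausy]] := cA u u1.
have [n|r roo Busr] := cB (u \o s); first exact: u1.
exists (s \o r); first exact: (cvg_comp _ _ roo soo).
apply: is_cvgD; last exact: Busr.
by apply/cvg_ex; exists y; exact: (cvg_comp _ _ roo Ausy).
Qed.

Lemma seq_compact_sum (I : Type) (r : seq I) (A : I -> V -> W) :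
  (forall i, seq_compact (A i)) -> seq_compact (fun x => \sum_(i <- r) A i x).
Proof.
move=> cA; elim: r => [|i r IHr].
  under eq_fun do rewrite big_nil.
  by move=> u _; exists id; [exact: cvg_id|exact: is_cvg_cst].
by under eq_fun do rewrite big_cons; exact: seq_compactD.
Qed.

End SequentialCompactness.

Lemma compact_op_seq_compact (R : realType) (H : completeNormedModType R[i])
    (A : H -> H) : compact_op A -> seq_compact A.
Proof. by case=> _; exact: precompact_seq_compact. Qed.

Lemma seq_compact_comp (R : realType) (U V W : normedModType R[i])
    (A : V -> W) (B : U -> V) :
  continuous A -> seq_compact B -> seq_compact (A \o B).
Proof.
move=> contA cB u /cB[s soo /cvg_ex[y Busy]]; exists s => //.
by apply/cvg_ex; exists (A y); apply: (cvg_comp _ _ Busy); exact: contA.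
Qed.

Lemma seq_compact_dominated (R : realType) (U V : normedModType R[i])
    (W : completeNormedModType R[i])
    (A : {linear U -> W}) (B : {linear U -> V}) :
  seq_compact B -> (forall x, rnorm (A x) <= rnorm (B x)) -> seq_compact A.
Proof.
move=> cB leAB u u1; have [s soo /cvg_ex[y Busy]] := cB u u1; exists s => //.
apply: cauchy_cvg; apply: cauchy_exP => _/gt0_complexE[e e0 ->].
have e20 : 0 < e / 2 by rewrite divr_gt0.
have near_y : \forall n \near \oo, rnorm (B (u (s n)) - y) < e / 2.
  exact: cvg_near_rnorm_lt e20 Busy.
have [N ByN] := filter_ex near_y; exists (A (u (s N))).
apply: (filterS _ near_y) => n Byn; rewrite -ball_normE /= norm_rnormE ltcR.
rewrite -linearB; apply: le_lt_trans (leAB _) _; rewrite linearB.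
have := rnorm_dist_le (B (u (s N))) y (B (u (s n))); lra.
Qed.

(** * Eigenvectors of a compact self-adjoint operator *)

Lemma choice_from_prefix (T : Type) (P : seq T -> T -> Prop) :
  (forall s, exists x, P s x) ->
  exists u : nat -> T, forall n, P (mkseq u n) (u n).
Proof.
move=> /choice[f fP]; pose s n := iter n (fun s => rcons s (f s)) [::].
exists (f \o s) => n; suff -> : mkseq (f \o s) n = s n by exact: fP.
by elim: n => // n IHn; rewrite mkseqS IHn.
Qed.

Section MaximalEigenpair.
Variables (R : realType) (H : completeNormedModType R[i]).
Variable dot : {dot H for Num.conj}.
Hypothesis dotE : hilbert_dot dot.
Local Notation rdot := (rdot dot).

Lemma form_le_bound (A : H -> H) (K : R) :
  (forall x, rnorm (A x) <= K * rnorm x) ->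
  forall x, rdot (A x) x <= K * rnorm x ^+ 2.
Proof.
move=> AK x; apply: le_trans (rdot_le dotE _ _) _.
by rewrite expr2 mulrA ler_wpM2r ?rnorm_ge0.
Qed.

Lemma form_maximizing_sequence (A : {linear H -> H}) (F : set H) (K : R) :
  (forall x, rnorm (A x) <= K * rnorm x) -> subspace F ->
  (exists2 x, F x & 0 < rdot (A x) x) ->
  exists M : R, [/\ 0 < M, forall x, F x -> rdot (A x) x <= M * rnorm x ^+ 2 &
    exists u : nat -> H, [/\ forall n, F (u n), forall n, rnorm (u n) = 1 &
      rdot (A (u n)) (u n) @[n --> \oo] --> M]].
Proof.
move=> AK subF [x0 Fx0 Ax0].
pose S := [set rdot (A x) x | x in [set x | F x /\ rnorm x = 1]].
have rayleigh x : F x -> x != 0 -> S (rdot (A x) x / rnorm x ^+ 2).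
  move=> Fx x0n; exists ((rnorm x)^-1%:C%C *: x).
    by split; [exact: subspaceZ|exact: rnorm_normalize].
  by rewrite linearZ rdotZl rdotZr mulrA -expr2 exprVn mulrC.
have x0n : x0 != 0 by apply: contraTneq Ax0 => ->; rewrite linear0 rdot0l ltxx.
have supS : has_sup S.
  split; first by eexists; exact: rayleigh Fx0 x0n.
  exists K => _ [x [Fx x1] <-]; apply: le_trans (form_le_bound AK x) _.
  by rewrite x1 expr1n mulr1.
have le_sup r : S r -> r <= sup S by move=> Sr; exact: (ub_le_sup supS.2 Sr).
exists (sup S); split.
- apply: lt_le_trans (le_sup _ (rayleigh _ Fx0 x0n)).
  by rewrite divr_gt0 ?exprn_gt0 ?rnorm_gt0.
- move=> x Fx; have [->|xn0] := eqVneq x 0.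
    by rewrite linear0 rdot0l rnorm0 expr0n mulr0.
  by rewrite -ler_pdivrMr ?exprn_gt0 ?rnorm_gt0//; exact/le_sup/rayleigh.
have /choice[u uP] : forall n, exists x,
    [/\ F x, rnorm x = 1 & sup S - harmonic n < rdot (A x) x].
  move=> n; have [|_ [x [Fx x1] <-] ltx] :=
    sup_adherent (_ : 0 < harmonic n) supS; first exact: harmonic_gt0.
  by exists x.
exists u; split=> [n|n|]; [by case: (uP n)|by case: (uP n)|].
apply: (squeeze_cvgr (f := fun n => sup S - harmonic n) (h := cst (sup S))).
- apply: nearW => n; have [Fun un1 ltu] := uP n.
  by rewrite ltW//=; apply: le_sup; exists (u n).
- rewrite -[X in _ --> X]subr0; apply: cvgB; first exact: cvg_cst.
  exact: cvg_harmonic.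
exact: cvg_cst.
Qed.

Definition max_eigenpair (A : H -> H) (F : set H) (e : H) (l : R) :=
  [/\ F e, 0 <= l, A e = l%:C%C *: e, dot e e = (l != 0)%:R &
      forall x, F x -> rdot (A x) x <= l * rnorm x ^+ 2].

Section CompactSelfadjoint.
Variable A : {linear H -> H}.
Hypotheses (saA : selfadjoint dot A) (cA : seq_compact A).

(* [rnorm_sqr_le_form] applies to the operator [M - A], positive on [F]. *)
Lemma maximizing_sequence_residual (F : set H) (M : R) (u : nat -> H) :
  subspace F -> (forall x, F x -> F (A x)) ->
  (forall x, F x -> rdot (A x) x <= M * rnorm x ^+ 2) ->
  (forall n, F (u n)) -> (forall n, rnorm (u n) = 1) ->
  rdot (A (u n)) (u n) @[n --> \oo] --> M ->
  M%:C%C *: u n - A (u n) @[n --> \oo] --> 0.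
Proof.
move=> subF FA AM Fu u1 uM; have [K K0 AK] := seq_compact_bounded cA.
pose T : {linear H -> H} := (M%:C%C \*: idfun) \- A.
have TE x : T x = M%:C%C *: x - A x by [].
have rT x : rdot (T x) x = M * rnorm x ^+ 2 - rdot (A x) x.
  by rewrite TE rdotBl rdotZl rdotxx.
have saT : selfadjoint dot T.
  by move=> x y; rewrite !TE linearBl linearBr /= dotZl dotZr_real saA.
have FT x : F x -> F (T x).
  move=> Fx; rewrite TE -[- A x]scaleN1r; apply: subspaceD => //.
    exact: subspaceZ.
  by apply: subspaceZ => //; exact: FA.
have formT x : F x -> 0 <= rdot (T x) x <= (M + K) * rnorm x ^+ 2.
  move=> Fx; rewrite rT subr_ge0 AM//= mulrDl lerD2l -rdotNl.
  by apply: (form_le_bound (A := fun x => - A x)) => z; rewrite rnormN.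
apply: rnorm_sqr_cvg0.
apply: (squeeze_cvgr (f := cst 0)
    (h := fun n => (M + K) * (M - rdot (A (u n)) (u n)))).
- apply: nearW => n; rewrite sqr_ge0 /=.
  have := rnorm_sqr_le_form dotE saT subF FT formT (Fu n).
  by rewrite rT u1 expr1n mulr1.
- exact: cvg_cst.
rewrite -[X in _ --> X](mulr0 (M + K)) -(subrr M).
by apply: cvgMl_tmp; apply: cvgB => //; exact: cvg_cst.
Qed.

Lemma approximate_eigenvectors_limit (M : R) (u : nat -> H) :
  0 < M -> (forall n, rnorm (u n) = 1) ->
  M%:C%C *: u n - A (u n) @[n --> \oo] --> 0 ->
  exists s : nat -> nat, exists2 y, M%:C%C *: u (s n) @[n --> \oo] --> y &
    rnorm y = M /\ A y = M%:C%C *: y.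
Proof.
move=> M0 u1 res; have [n|s soo /cvg_ex[y Ausy]] := cA (u := u).
  by rewrite u1.
have Musy : M%:C%C *: u (s n) @[n --> \oo] --> y.
  rewrite -[y]add0r.
  under eq_fun => n do rewrite -(subrK (A (u (s n))) (_ *: _)).
  exact: cvgD (cvg_comp _ _ soo res) Ausy.
exists s, y => //; split.
  have normMus n : rnorm (M%:C%C *: u (s n)) = M.
    by rewrite rnormZ u1 mulr1 gtr0_norm.
  have cvgM : M @[_ --> \oo] --> rnorm y.
    by rewrite -(funext normMus); exact: rnorm_cvg.
  exact: norm_cvg_unique cvgM (cvg_cst M).
have AMusy : M%:C%C *: A (u (s n)) @[n --> \oo] --> A y.
  under eq_fun do rewrite -linearZ.
  by apply: (cvg_comp _ _ Musy); exact: seq_compact_continuous.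
exact: norm_cvg_unique AMusy (cvgZl_tmp Ausy).
Qed.

Lemma max_eigenpair_ex (F : set H) :
  subspace F -> closed F -> (forall x, F x -> F (A x)) ->
  exists e l, max_eigenpair A F e l.
Proof.
move=> subF clF FA.
have [pos|npos] := pselect (exists2 x, F x & 0 < rdot (A x) x).
  have [K K0 AK] := seq_compact_bounded cA.
  have [M [M0 AM [u [Fu u1 uM]]]] := form_maximizing_sequence AK subF pos.
  have res := maximizing_sequence_residual subF FA AM Fu u1 uM.
  have [s [y Musy [yM Ay]]] := approximate_eigenvectors_limit M0 u1 res.
  have Fy : F y.
    by apply: closed_cvg clF _ _ Musy; apply: nearW => n; exact: subspaceZ.
  have y0 : y != 0 by rewrite -rnorm_gt0 yM.
  exists ((rnorm y)^-1%:C%C *: y), M; split=> //; first exact: subspaceZ.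
  - exact: ltW.
  - by rewrite linearZ /= Ay !scalerA mulrC.
  - by rewrite dotxx// rnorm_normalize// expr1n gt_eqF.
exists 0, 0; split=> //; first exact: subF.1.
- by rewrite linear0 scaler0.
- by rewrite linear0l eqxx.
by move=> x Fx; rewrite mul0r leNgt; apply/negP => ?; apply: npos; exists x.
Qed.

End CompactSelfadjoint.
End MaximalEigenpair.

Section Orthonormal.
Variables (R : realType) (H : completeNormedModType R[i]).
Variable dot : {dot H for Num.conj}.
Local Notation rdot := (rdot dot).

Definition orthonormal0 (I : eqType) (e : I -> H) :=
  forall i j, dot (e i) (e j) = ((i == j) && (e i != 0))%:R.

Definition orth_prefix (e : nat -> H) n : set H :=
  orth dot (fun i : 'I_n => e i).

Lemma orth_prefixP (e : nat -> H) n x :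
  orth_prefix e n x <-> forall i, (i < n)%N -> dot x (e i) = 0.
Proof. by split=> [ox i ltin|ox i]; [exact: (ox (Ordinal ltin))|exact: ox]. Qed.

Lemma orthonormal0_comp (I J : eqType) (e : I -> H) (f : J -> I) :
  injective f -> orthonormal0 e -> orthonormal0 (e \o f).
Proof. by move=> injf eON i j; rewrite /= eON (inj_eq injf). Qed.

Section Expansion.
Variables (I : eqType) (e : I -> H).
Hypothesis eON : orthonormal0 e.
Implicit Types (a b : I -> R) (r : seq I) (x : H).

Definition diag_sum a r x := \sum_(i <- r) (a i)%:C%C *: (dot x (e i) *: e i).

Lemma diag_sum_linear a r : linear (diag_sum a r).
Proof.
move=> c x y; rewrite /diag_sum scaler_sumr -big_split /=.
apply: eq_bigr => i _; rewrite linearDl /= dotZl scalerDl scalerDr !scalerA.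
by rewrite mulrCA mulrA.
Qed.

HB.instance Definition _ a r :=
  GRing.isLinear.Build R[i] H H *:%R (diag_sum a r) (diag_sum_linear a r).

Lemma diag_sum_selfadjoint a r : selfadjoint dot (diag_sum a r).
Proof.
move=> x y; rewrite linear_sumlz linear_sumr; apply: eq_bigr => i _.
by rewrite /= !dotZl dotZr_real dotZr -(dotC dot) [dot x _ * _]mulrC.
Qed.

Lemma dotK_orthonormal0 x i : dot x (e i) * dot (e i) (e i) = dot x (e i).
Proof.
have [->|ei0] := eqVneq (e i) 0; first by rewrite linear0r mul0r.
by rewrite eON eqxx ei0 mulr1.
Qed.

Lemma dot_diag_sum a r x j : uniq r ->
  dot (diag_sum a r x) (e j) = if j \in r then (a j)%:C%C * dot x (e j) else 0.
Proof.
move=> ur; rewrite linear_sumlz; case: ifPn => jr; last first.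
  rewrite big_seq big1 // => i ir; rewrite /= !dotZl eON.
  by rewrite (_ : i == j = false) ?mulr0//; apply: contraNF jr => /eqP <-.
rewrite (bigD1_seq j)//= big1 => [|i ij].
  by rewrite addr0 !dotZl dotK_orthonormal0.
by rewrite !dotZl eON (negPf ij) !mulr0.
Qed.

Lemma rdot_diag_sum a r x :
  rdot (diag_sum a r x) x =
  \sum_(i <- r) a i * rnorm (dot x (e i) : R[i]^o) ^+ 2.
Proof.
rewrite rdot_suml; apply: eq_bigr => i _.
rewrite rdotZl /rdot dotZl; congr (_ * _).
by rewrite (dotC dot (e i)) -normCK (norm_rnormE (_ : R[i]^o)) -rmorphXn.
Qed.

Lemma diag_sum_comp a b r x : uniq r ->
  diag_sum a r (diag_sum b r x) = diag_sum (fun i => a i * b i) r x.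
Proof.
move=> ur; rewrite /diag_sum big_seq [RHS]big_seq; apply: eq_bigr => i ir.
by rewrite -/(diag_sum b r x) dot_diag_sum// ir !scalerA rmorphM mulrA.
Qed.

Lemma eigen_diag_sum (T : {linear H -> H}) l a r x :
  (forall i, T (e i) = (l i)%:C%C *: e i) ->
  T (diag_sum a r x) = diag_sum (fun i => l i * a i) r x.
Proof.
move=> Te; rewrite linear_sum; apply: eq_bigr => i _.
by rewrite !linearZ /= Te !scalerA rmorphM /=; congr (_ *: _); ring.
Qed.

Lemma rdot_diag_sum2 a b r x : uniq r ->
  rdot (diag_sum a r x) (diag_sum b r x) =
  \sum_(i <- r) a i * b i * rnorm (dot x (e i) : R[i]^o) ^+ 2.
Proof.
move=> ur; rewrite (selfadjoint_rdot (@diag_sum_selfadjoint _ _)).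
by rewrite diag_sum_comp// rdotC rdot_diag_sum.
Qed.

Hypothesis dotE : hilbert_dot dot.

Lemma rnorm_sqr_diag_sum a r x : uniq r ->
  rnorm (diag_sum a r x) ^+ 2 =
  \sum_(i <- r) a i ^+ 2 * rnorm (dot x (e i) : R[i]^o) ^+ 2.
Proof. by move=> ur; rewrite -(rdotxx dotE) rdot_diag_sum2. Qed.

Lemma rnorm_sqr_projection_residual r x : uniq r ->
  rnorm (x - diag_sum (fun=> 1) r x) ^+ 2 =
  rnorm x ^+ 2 - \sum_(i <- r) rnorm (dot x (e i) : R[i]^o) ^+ 2.
Proof.
move=> ur; rewrite (rnorm_sqrB dotE) rnorm_sqr_diag_sum// rdotC rdot_diag_sum.
under eq_bigr do rewrite mul1r.
under [X in _ + X]eq_bigr do rewrite expr1n mul1r.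
by ring.
Qed.

Lemma bessel r x : uniq r ->
  \sum_(i <- r) rnorm (dot x (e i) : R[i]^o) ^+ 2 <= rnorm x ^+ 2.
Proof.
by move=> ur; rewrite -subr_ge0 -rnorm_sqr_projection_residual// sqr_ge0.
Qed.

Lemma rnorm_projection_residual_le r x : uniq r ->
  rnorm (x - diag_sum (fun=> 1) r x) ^+ 2 <= rnorm x ^+ 2.
Proof.
move=> ur; rewrite rnorm_sqr_projection_residual// gerBl.
by apply: sumr_ge0 => i _; exact: sqr_ge0.
Qed.

Lemma orth_projection_residual r x j : uniq r -> j \in r ->
  dot (x - diag_sum (fun=> 1) r x) (e j) = 0.
Proof. by move=> ur jr; rewrite linearBl /= dot_diag_sum// jr mul1r subrr. Qed.

Lemma dot_orthonormal0_sum r (c : I -> R[i]) j :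
  uniq r -> j \in r -> e j != 0 ->
  dot (\sum_(i <- r) c i *: e i) (e j) = c j.
Proof.
move=> ur jr ej0; rewrite linear_sumlz (bigD1_seq j)//= big1 => [|i ij].
  by rewrite addr0 dotZl eON eqxx ej0 mulr1.
by rewrite dotZl eON (negPf ij) mulr0.
Qed.

End Expansion.
End Orthonormal.

Section EigenSystem.
Variables (R : realType) (H : completeNormedModType R[i]).
Variable dot : {dot H for Num.conj}.
Hypothesis dotE : hilbert_dot dot.
Local Notation rdot := (rdot dot).

(* The [e n] with [l n != 0] are the eigenvectors of the positive eigenvalues;
   once these are exhausted, [l n = 0] and [e n = 0]. *)
Definition eigen_system (A : H -> H) (e : nat -> H) (l : nat -> R) :=
  forall n, max_eigenpair dot A (orth_prefix dot e n) (e n) (l n).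

Section Properties.
Variables (A : H -> H) (e : nat -> H) (l : nat -> R).
Hypothesis sys : eigen_system A e l.

Lemma eigen_system_ge0 n : 0 <= l n.
Proof. by have [] := sys n. Qed.

Lemma eigen_system_eigen n : A (e n) = (l n)%:C%C *: e n.
Proof. by have [] := sys n. Qed.

Lemma eigen_system_form_le n x :
  orth_prefix dot e n x -> rdot (A x) x <= l n * rnorm x ^+ 2.
Proof. by have [_ _ _ _] := sys n; exact. Qed.

Lemma eigen_system_eq0 n : (e n == 0) = (l n == 0).
Proof.
by have [_ _ _ en _] := sys n; rewrite -(dnorm_eq0 dot) en pnatr_eq0 eqb0 negbK.
Qed.

Lemma eigen_system_orthonormal0 : orthonormal0 dot e.
Proof.
have ltn_orth m n : (m < n)%N -> dot (e n) (e m) = 0.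
  by move=> mn; have [/orth_prefixP en _ _ _ _] := sys n; exact: en.
move=> m n; case: ltngtP => //= [mn|nm|->]; last first.
- by have [_ _ _ -> _] := sys n; rewrite eigen_system_eq0.
- exact: ltn_orth.
by rewrite dotC ltn_orth// conjC0.
Qed.

Lemma rnorm_eigen_system n : l n != 0 -> rnorm (e n) ^+ 2 = 1.
Proof.
move=> ln0; rewrite -(rdotxx dotE) /rdot eigen_system_orthonormal0 eqxx.
by rewrite eigen_system_eq0 ln0.
Qed.

Lemma eigen_system_nonincr : {homo l : m n / (m <= n)%N >-> n <= m}.
Proof.
move=> m n mn; have [->|ln0] := eqVneq (l n) 0; first exact: eigen_system_ge0.
have := eigen_system_form_le (n := m) (x := e n).
rewrite eigen_system_eigen rdotZl rdotxx// rnorm_eigen_system// !mulr1; apply.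
apply/orth_prefixP => i im; rewrite eigen_system_orthonormal0.
by rewrite gtn_eqF// (leq_trans im).
Qed.

End Properties.

Section Span.
Variables (A : {linear H -> H}) (e : nat -> H) (l : nat -> R).
Hypothesis sys : eigen_system A e l.
Variables (t : R) (n : nat) (c : 'I_n -> R[i]).
Hypotheses (t_gt0 : 0 < t) (le_tl : forall i : 'I_n, t <= l i).
Let y := \sum_i c i *: e i.

Let eON : orthonormal0 dot (fun i : 'I_n => e i).
Proof. exact: orthonormal0_comp val_inj (eigen_system_orthonormal0 sys). Qed.

Let dot_y (i : 'I_n) : dot y (e i) = c i.
Proof.
apply: (dot_orthonormal0_sum eON); rewrite ?index_enum_uniq ?mem_index_enum//=.
by rewrite (eigen_system_eq0 sys) gt_eqF// (lt_le_trans t_gt0).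
Qed.

Let yE : y = diag_sum dot (fun i : 'I_n => e i) (fun=> 1) (index_enum _) y.
Proof. by apply: eq_bigr => i _; rewrite dot_y scale1r. Qed.

Let AyE a : A (diag_sum dot (fun i : 'I_n => e i) a (index_enum _) y) =
  diag_sum dot (fun i : 'I_n => e i) (fun i => l i * a i) (index_enum _) y.
Proof. by apply: eigen_diag_sum => i; exact: eigen_system_eigen sys i. Qed.

Lemma eigen_span_neq0 : (exists i, c i != 0) -> y != 0.
Proof. by move=> [j]; apply: contra_neq => y0; rewrite -dot_y y0 linear0l. Qed.

Lemma eigen_span_norm_ge : t * rnorm y <= rnorm (A y).
Proof.
rewrite -(ler_pXn2r (n := 2))// ?nnegrE ?mulr_ge0 ?rnorm_ge0 ?(ltW t_gt0)//.
rewrite exprMn yE AyE !(rnorm_sqr_diag_sum eON) ?index_enum_uniq// mulr_sumr.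
apply: ler_sum => i _; rewrite expr1n mul1r mulr1 ler_wpM2r ?sqr_ge0//.
by rewrite lerXn2r ?nnegrE ?(eigen_system_ge0 sys) ?(ltW t_gt0).
Qed.

Lemma eigen_span_form_ge : t * rnorm (A y) ^+ 2 <= rdot (A (A y)) (A y).
Proof.
rewrite yE !AyE (rnorm_sqr_diag_sum eON)// ?index_enum_uniq//.
rewrite (rdot_diag_sum2 eON) ?index_enum_uniq// mulr_sumr.
apply: ler_sum => i _; rewrite mulr1 mulrA ler_wpM2r ?sqr_ge0// -mulrA -expr2.
by rewrite ler_wpM2r ?sqr_ge0.
Qed.

End Span.

Section CompactSelfadjoint.
Variable A : {linear H -> H}.
Hypotheses (saA : selfadjoint dot A) (cA : seq_compact A).

Lemma eigen_system_ex : exists e l, eigen_system A e l.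
Proof.
pose eigenvectors (s : seq H) := forall i, (i < size s)%N ->
  exists l : R, A (nth 0 s i) = l%:C%C *: nth 0 s i.
have [s|e eP] := @choice_from_prefix H (fun s e => eigenvectors s ->
    exists l, max_eigenpair dot A (orth_prefix dot (nth 0 s) (size s)) e l).
  have [eig|neig] := pselect (eigenvectors s); last by exists 0.
  have [||x ox|e [l el]] := max_eigenpair_ex dotE saA cA
    (F := orth_prefix dot (nth 0 s) (size s)).
  - exact: subspace_orth.
  - exact: closed_orth.
  - by apply: orth_eigenvectors => // i; exact: eig.
  by exists e => _; exists l.
have orthE n : orth_prefix dot (nth 0 (mkseq e n)) n = orth_prefix dot e n.
  apply/seteqP; split=> x ox i.
    by have := ox i; rewrite nth_mkseq.
  by rewrite nth_mkseq//; exact: ox.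
have /choice[l sys] : forall n, exists l,
    max_eigenpair dot A (orth_prefix dot e n) (e n) l.
  elim/ltn_ind => n IHn; have [i|l] := eP n; last first.
    by rewrite size_mkseq orthE; exists l.
  rewrite size_mkseq => ltin; rewrite nth_mkseq//.
  by have [l [_ _ Ae _ _]] := IHn i ltin; exists l.
by exists e, l.
Qed.

Variables (e : nat -> H) (l : nat -> R).
Hypothesis sys : eigen_system A e l.

(* Otherwise the [A e_n] would stay at distance [>= r] from each other. *)
Lemma eigen_system_lt (r : R) : 0 < r -> exists n, l n < r.
Proof.
move=> r0; apply/not_existsP => ge_r.
have rl n : r <= l n by rewrite leNgt; apply/negP/ge_r.
have l0 n : l n != 0 by rewrite gt_eqF// (lt_le_trans r0).
have [n|s soo /cvg_ex[y Aesy]] := cA (u := e).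
  by rewrite -(expr_le1 (n := 2)) ?rnorm_ge0// (rnorm_eigen_system sys).
have r20 : 0 < r / 2 by rewrite divr_gt0.
have near_y : \forall n \near \oo, rnorm (A (e (s n)) - y) < r / 2.
  exact: cvg_near_rnorm_lt r20 Aesy.
have [m Aem] := filter_ex near_y.
have /filter_ex[n [Aen smn]] : \forall n \near \oo,
    rnorm (A (e (s n)) - y) < r / 2 /\ (s m < s n)%N.
  by apply: filterI => //; move/cvgnyPgt: soo; exact.
have lt_r : rnorm (A (e (s n)) - A (e (s m))) < r.
  by have := rnorm_dist_le (A (e (s n))) y (A (e (s m))); lra.
have : rnorm (A (e (s n)) - A (e (s m))) ^+ 2 = l (s n) ^+ 2 + l (s m) ^+ 2.
  rewrite (rnorm_sqrB dotE) !(eigen_system_eigen sys) !rnormZ rdotZl rdotZr.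
  rewrite /rdot (eigen_system_orthonormal0 sys) gtn_eqF// !mulr0 subr0 !exprMn.
  by rewrite !(rnorm_eigen_system sys)// !mulr1 !real_normK ?num_real.
have := rnorm_ge0 (A (e (s n)) - A (e (s m))).
have := rl (s n); have := rl (s m); nra.
Qed.

Lemma eigen_system_cvg0 : l n @[n --> \oo] --> 0.
Proof.
apply/cvgr0Pnorm_lt => r r0; have [N lN] := eigen_system_lt r0; near=> n.
rewrite ger0_norm ?(eigen_system_ge0 sys)//.
apply: le_lt_trans (eigen_system_nonincr sys _) lN.
by near: n; exact: nbhs_infty_ge.
Unshelve. all: by end_near. Qed.

Section Eigenvalue.
Variables (mu : R) (s : seq nat).
Hypotheses (mu_gt0 : 0 < mu) (us : uniq s).
Hypothesis mem_s : forall n, (n \in s) = (l n == mu).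

(* The residual of the projection of [x] onto the [e n], [n \in s], is an
   eigenvector for [mu] and orthogonal to all [e n], hence zero. *)
Lemma eigenspace_expansion x : eigenspace_op A mu x ->
  x = diag_sum dot e (fun=> 1) s x.
Proof.
move=> Ax; have eON := eigen_system_orthonormal0 sys.
apply/eqP; rewrite -subr_eq0; set y := x - _.
have yo n : dot y (e n) = 0.
  have [ns|] := boolP (n \in s); first exact: orth_projection_residual.
  rewrite /y linearBl /= (dot_diag_sum eON)// mem_s => /[dup] lmu /negPf->.
  rewrite subr0; have : dot (A x) (e n) = dot x (A (e n)) by exact: saA.
  rewrite Ax (eigen_system_eigen sys) dotZl dotZr_real => /eqP.
  rewrite -subr_eq0 -mulrBl mulf_eq0 subr_eq0 (inj_eq (@complexI R)).
  by rewrite eq_sym (negPf lmu) => /eqP.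
have Ay : A y = mu%:C%C *: y.
  rewrite /y linearB linear_sum scalerBr scaler_sumr Ax; congr (_ - _).
  rewrite big_seq [RHS]big_seq; apply: eq_bigr => n; rewrite mem_s => /eqP ln.
  by rewrite !linearZ /= (eigen_system_eigen sys) ln !scale1r !scalerA mulrC.
have [N lN] := eigen_system_lt mu_gt0.
have := eigen_system_form_le sys (n := N) (fun i => yo i).
rewrite Ay rdotZl rdotxx//; have [//|y0] := eqVneq y 0.
by rewrite ler_pM2r ?exprn_gt0 ?rnorm_gt0// leNgt lN.
Qed.

Lemma eigenspace_has_dim : has_dim (eigenspace_op A mu) (size s).
Proof.
have ns i : nth 0%N s (i : 'I_(size s)) \in s by exact: mem_nth.
have lmu i : l (nth 0%N s (i : 'I_(size s))) = mu by apply/eqP; rewrite -mem_s.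
have inj_nth : injective (fun i : 'I_(size s) => nth 0%N s i).
  by move=> i j /eqP; rewrite nth_uniq// => /eqP/val_inj.
have eON := orthonormal0_comp inj_nth (eigen_system_orthonormal0 sys).
exists (fun i => e (nth 0%N s i)); split=> [i|c sum0 i|x Ax].
- by rewrite /eigenspace_op /= (eigen_system_eigen sys) lmu.
- suff <- : dot 0 (e (nth 0%N s i)) = c i by exact: linear0l.
  rewrite -sum0.
  apply: (dot_orthonormal0_sum eON) => /=; rewrite ?index_enum_uniq//.
    exact: mem_index_enum.
  by rewrite (eigen_system_eq0 sys) lmu gt_eqF.
exists (fun i => dot x (e (nth 0%N s i))).
rewrite [LHS](eigenspace_expansion Ax) /diag_sum (big_nth 0%N) big_mkord.
by apply: eq_bigr => i _; rewrite scale1r.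
Qed.

End Eigenvalue.

Lemma eigen_system_eigenseq : is_pos_eigenseq A l.
Proof.
split; [exact: eigen_system_ge0 sys|exact: eigen_system_nonincr sys|].
move=> mu mu0; have [N lN] := eigen_system_lt mu0.
pose s := [seq n <- iota 0 N | l n == mu].
have us : uniq s by rewrite filter_uniq ?iota_uniq.
have mem_s n : (n \in s) = (l n == mu).
  rewrite mem_filter mem_iota add0n /=; case: eqP => //= ln.
  rewrite ltnNge; apply/negP => /(eigen_system_nonincr sys).
  by rewrite ln leNgt lN.
exists (size s); first exact: eigenspace_has_dim.
rewrite card_eq_sym; apply/card_set_bijP; exists (nth 0 s)%N; split.
- by move=> i /= ltis; apply/eqP; rewrite -mem_s mem_nth.
- by move=> i j; rewrite !inE /= => lti ltj /eqP; rewrite nth_uniq// => /eqP.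
move=> n /= /eqP; rewrite -mem_s => ns.
exists (index n s); last exact: nth_index.
by rewrite /= index_mem.
Qed.

End CompactSelfadjoint.
End EigenSystem.

(** * Uniqueness of the eigenvalue sequence *)

Lemma nontrivial_solution (F : fieldType) (I J : finType) (w : I -> J -> F) :
  (#|J| < #|I|)%N ->
  exists2 c : I -> F, (exists i, c i != 0) & forall j, \sum_i c i * w i j = 0.
Proof.
move=> ltJI; pose M := \matrix_(i < #|I|, j < #|J|) w (enum_val i) (enum_val j).
have : kermx M != 0.
  rewrite -mxrank_eq0 mxrank_ker subn_eq0 -ltnNge.
  exact: leq_ltn_trans (rank_leq_col M) ltJI.
case/matrix0Pn => k [i0 kM0].
exists (fun i => kermx M k (enum_rank i)).
  by exists (enum_val i0); rewrite enum_valK.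
move=> j; have /matrixP/(_ k (enum_rank j)) := mulmx_ker M.
rewrite !mxE => kM.
rewrite -[RHS]kM (reindex (@enum_val I predT)) /=; last first.
  by apply: onW_bij; exact: enum_val_bij.
by apply: eq_bigr => i _; rewrite !mxE enum_valK enum_rankK.
Qed.

Section PositiveEigenvalueSequence.
Variables (R : realType) (H : completeNormedModType R[i]).
Implicit Types (E : set H) (A : H -> H) (l : nat -> R).

Lemma has_dim_le E (d d' : nat) : has_dim E d -> has_dim E d' -> (d <= d')%N.
Proof.
move=> [e [eE eI _]] [e' [_ _ eS']]; rewrite leqNgt; apply/negP => dd.
have /choice[M MP] : forall i, exists c : 'I_d' -> R[i],
    e i = \sum_j c j *: e' j by move=> i; exact: eS'.
have [|c [i /negP ci] cM] := @nontrivial_solution R[i] 'I_d 'I_d' M.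
  by rewrite !card_ord.
apply/ci/eqP/eI; under eq_bigr do rewrite MP scaler_sumr.
rewrite exchange_big /= big1// => j _.
under eq_bigr do rewrite scalerA.
by rewrite -scaler_suml cM scale0r.
Qed.

(* If [l n > l' n], then the value [l n] would occur more often in [l]. *)
Lemma is_pos_eigenseq_le A l l' n :
  is_pos_eigenseq A l -> is_pos_eigenseq A l' ->
  (forall i, (i < n)%N -> l i = l' i) -> l n <= l' n.
Proof.
move=> [_ _ lcard] [l'0 l'dec l'card] eql; rewrite leNgt; apply/negP => ltl.
have mu0 : 0 < l n by exact: le_lt_trans (l'0 n) ltl.
have [d dE cd] := lcard _ mu0; have [d' dE' cd'] := l'card _ mu0.
have dd' : d' = d.
  by apply/eqP; rewrite eqn_leq !(@has_dim_le (eigenspace_op A (l n))).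
rewrite {d' dE'}dd' in cd'; set S' := [set _ | _] in cd'.
have ltS' i : S' i -> (i < n)%N.
  rewrite /S' /= => l'i; rewrite ltnNge; apply/negP => /l'dec.
  by rewrite l'i leNgt ltl.
have cardS' : (S' `|` [set n] #= `I_d.+1)%card.
  apply/eq_cardSP; exists n; first by right.
  suff -> : (S' `|` [set n]) `\ n = S' by [].
  apply/seteqP; split=> [i [[//|->]]|i S'i]; first by move=> /(_ erefl).
  by split; [left|move=> /= ii; have := ltS' _ S'i; rewrite ii ltnn].
suff : (`I_d.+1 #<= `I_d)%card by rewrite card_le_II ltnn.
rewrite -(card_le_eqr cd) -(card_le_eql cardS'); apply: subset_card_le.
by move=> i [S'i|->//]; rewrite /= -S'i eql// ltS'.
Qed.

Lemma is_pos_eigenseq_uniq A l l' :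
  is_pos_eigenseq A l -> is_pos_eigenseq A l' -> l = l'.
Proof.
move=> lA l'A; apply/funext => n; elim/ltn_ind: n => n IHn.
apply/eqP; rewrite eq_le !(@is_pos_eigenseq_le A)// => i /IHn; exact: esym.
Qed.

Lemma lambda_plus_eigen_system (dot : {dot H for Num.conj})
    (A : {linear H -> H}) :
  hilbert_dot dot -> selfadjoint dot A -> seq_compact A ->
  exists e, eigen_system dot A e (lambda_plus A).
Proof.
move=> dotE saA cA; have [e [l sys]] := eigen_system_ex dotE saA cA.
exists e; suff -> : lambda_plus A = l by [].
have lP := eigen_system_eigenseq dotE saA cA sys.
apply: (is_pos_eigenseq_uniq _ lP).
by rewrite /lambda_plus; apply: xgetPex; exists l.
Qed.

End PositiveEigenvalueSequence.

(** * Square roots and singular values *)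

Section DiagonalOperators.
Variables (R : realType) (H : completeNormedModType R[i]).
Variable dot : {dot H for Num.conj}.
Hypothesis dotE : hilbert_dot dot.
Local Notation rdot := (rdot dot).

Section DiagonalOperator.
Variable e : nat -> H.
Hypothesis eON : orthonormal0 dot e.
Implicit Types (a : nat -> R) (C : R).

Definition diag_op a x : H :=
  limn (fun n => diag_sum dot e a (index_iota 0 n) x).

Lemma diag_op_cvg a C x : (forall n, `|a n| <= C) ->
  diag_sum dot e a (index_iota 0 n) x @[n --> \oo] --> diag_op a x.
Proof.
move=> aC; pose c n := rnorm (dot x (e n) : R[i]^o) ^+ 2.
have c_cvg : cvgn (series c).
  apply: nondecreasing_is_cvgn.
    by apply: nondecreasing_series => n _ _; exact: sqr_ge0.
  by exists (rnorm x ^+ 2) => _ [n _ <-]; apply: bessel => //; exact: iota_uniq.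
suff : cvgn (series (fun n => (a n)%:C%C *: (dot x (e n) *: e n))) by [].
apply: cauchy_cvg; apply/cauchy_seriesP => _/gt0_complexE[r r0 ->].
have C0 : 0 <= C by exact: le_trans (normr_ge0 _) (aC 0%N).
have C1 : 0 < C ^+ 2 + 1 by rewrite ltr_wpDl ?sqr_ge0.
move/cvg_cauchy/cauchy_seriesP: c_cvg => /(_ _ (divr_gt0 (exprn_gt0 2 r0) C1)).
apply: filterS => -[m n] /=; rewrite ger0_norm => [ltc|]; last first.
  by apply: sumr_ge0 => k _; exact: sqr_ge0.
rewrite norm_rnormE ltcR -(ltr_pXn2r (n := 2))// ?nnegrE ?rnorm_ge0 ?ltW//.
rewrite -/(diag_sum dot e a (index_iota m n) x) rnorm_sqr_diag_sum ?iota_uniq//.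
move: ltc; rewrite ltr_pdivlMr//; apply: le_lt_trans.
rewrite mulrC mulr_sumr; apply: ler_sum => k _; rewrite ler_wpM2r ?sqr_ge0//.
by rewrite -(@real_normK _ (a k)) ?num_real// ler_wpDr// lerXn2r ?nnegrE.
Qed.

Section Bounded.
Variables (a : nat -> R) (C : R).
Hypothesis aC : forall n, `|a n| <= C.

Lemma diag_op_linear : linear (diag_op a).
Proof.
move=> c x y; have cvgD_xy : diag_sum dot e a (index_iota 0 n) (c *: x + y)
    @[n --> \oo] --> c *: diag_op a x + diag_op a y.
  under eq_fun do rewrite linearP.
  by apply: cvgD; [apply: cvgZl_tmp|]; exact: diag_op_cvg aC.
exact: norm_cvg_unique (diag_op_cvg aC) cvgD_xy.
Qed.

Lemma rnorm_diag_op_le x : rnorm (diag_op a x) <= C * rnorm x.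
Proof.
apply: (ler_cvg_to (rnorm_cvg (diag_op_cvg aC)) (cvg_cst _)); apply: nearW => n.
have C0 : 0 <= C by exact: le_trans (normr_ge0 _) (aC 0%N).
rewrite rnorm_le_sqr ?mulr_ge0 ?rnorm_ge0//.
rewrite rnorm_sqr_diag_sum ?iota_uniq// exprMn.
have un : uniq (index_iota 0 n) by exact: iota_uniq.
apply: le_trans (ler_wpM2l (sqr_ge0 C) (bessel eON dotE x un)).
rewrite mulr_sumr; apply: ler_sum => k _; rewrite ler_wpM2r ?sqr_ge0//.
by rewrite -(@real_normK _ (a k)) ?num_real// lerXn2r ?nnegrE.
Qed.

Lemma diag_op_selfadjoint : selfadjoint dot (diag_op a).
Proof.
move=> x y; apply: (dot_limE dotE (diag_op_cvg aC)).
under eq_fun do rewrite diag_sum_selfadjoint.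
exact: (dot_cvgr dotE (diag_op_cvg aC)).
Qed.

Lemma dot_diag_op x n : dot (diag_op a x) (e n) = (a n)%:C%C * dot x (e n).
Proof.
apply: (dot_limE dotE (diag_op_cvg aC)).
apply: cvg_near_cst; near=> m; rewrite dot_diag_sum ?iota_uniq//.
by rewrite mem_index_iota /= ifT//; near: m; exact: nbhs_infty_gt.
Unshelve. all: by end_near. Qed.

Lemma diag_op_ge0 : (forall n, 0 <= a n) -> positive_op dot (diag_op a).
Proof.
move=> a0 x; rewrite (selfadjoint_formE _ diag_op_selfadjoint) ler0c.
apply: (ler_cvg_to (cvg_cst 0) (rdot_cvgl dotE (diag_op_cvg aC))).
apply: nearW => n.
by rewrite rdot_diag_sum sumr_ge0// => k _; rewrite mulr_ge0 ?sqr_ge0.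
Qed.

End Bounded.

Lemma diag_op_comp a b C x : (forall n, `|b n| <= C) ->
  diag_op a (diag_op b x) = diag_op (fun n => a n * b n) x.
Proof.
move=> bC; congr (lim (_ @ \oo)); apply/funext => n; apply: eq_bigr => k _.
by rewrite -/(diag_op b x) (dot_diag_op bC) !scalerA rmorphM mulrA.
Qed.

End DiagonalOperator.

Section PositiveOperator.
Variables (B : {linear H -> H}) (e : nat -> H) (l : nat -> R).
Hypotheses (saB : selfadjoint dot B) (cB : seq_compact B).
Hypothesis posB : positive_op dot B.
Hypothesis sys : eigen_system dot B e l.

Lemma positive_eigen_system_le n x :
  orth_prefix dot e n x -> rnorm (B x) <= l n * rnorm x.
Proof.
move=> ox; have ln0 := eigen_system_ge0 sys n.
rewrite rnorm_le_sqr ?mulr_ge0 ?rnorm_ge0//.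
have B2 : rnorm (B x) ^+ 2 <= l n * rdot (B x) x.
  apply: (rnorm_sqr_le_form dotE saB _ _ _ ox); first exact: subspace_orth.
    apply: orth_eigenvectors => // i; exists (l i).
    exact: eigen_system_eigen sys i.
  by move=> y oy; rewrite positive_op_rdot_ge0//= (eigen_system_form_le sys).
rewrite (le_trans B2)// exprMn expr2 -mulrA ler_wpM2l//.
exact: (eigen_system_form_le sys ox).
Qed.

Lemma eigen_system_diag_op : B = diag_op e l :> (H -> H).
Proof.
have eON := eigen_system_orthonormal0 sys.
apply/funext => x; apply/esym/(cvg_lim (@norm_hausdorff _ _)).
apply/cvg_rnormP.
apply: (squeeze_cvgr (f := cst 0) (h := fun n => l n * rnorm x)).
- apply: nearW => n; rewrite rnorm_ge0 -rnormN opprB /=.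
  pose y := x - diag_sum dot e (fun=> 1) (index_iota 0 n) x.
  have -> : B x - diag_sum dot e l (index_iota 0 n) x = B y.
    rewrite linearB (eigen_diag_sum _ _ _ _ (eigen_system_eigen sys)).
    by under [in RHS]eq_fun do rewrite mulr1.
  apply: le_trans (positive_eigen_system_le (n := n) _) _.
    apply/orth_prefixP => i ltin; apply: orth_projection_residual => //.
      exact: iota_uniq.
    by rewrite mem_index_iota.
  rewrite ler_wpM2l ?(eigen_system_ge0 sys)//.
  rewrite rnorm_le_sqr ?rnorm_ge0//.
  by apply: rnorm_projection_residual_le => //; exact: iota_uniq.
- exact: cvg_cst.
rewrite -[X in _ --> X](mul0r (rnorm x)).
by apply: cvgMr_tmp; exact: eigen_system_cvg0 sys.
Qed.

Lemma sqrt_op_ex :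
  exists T, [/\ bounded_op T, selfadjoint dot T, positive_op dot T &
    T \o T = B].
Proof.
have eON := eigen_system_orthonormal0 sys; pose a n := Num.sqrt (l n).
have aC n : `|a n| <= Num.sqrt (l 0%N).
  rewrite ger0_norm ?sqrtr_ge0// ler_wsqrtr//.
  exact: (eigen_system_nonincr dotE sys).
exists (diag_op e a); split.
- split; first exact: (diag_op_linear eON aC).
  apply/(linear_continuousP (linear_pack (diag_op_linear eON aC))).
  exists (Num.sqrt (l 0%N) + 1) => [|x]; first by rewrite ltr_wpDl ?sqrtr_ge0.
  apply: le_trans (rnorm_diag_op_le eON aC x) _.
  by rewrite ler_wpM2r ?rnorm_ge0// lerDl.
- exact: (diag_op_selfadjoint eON aC).
- by apply: (diag_op_ge0 eON aC) => n; exact: sqrtr_ge0.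
rewrite eigen_system_diag_op; apply/funext => x /=.
rewrite (diag_op_comp eON _ _ aC); congr (diag_op _ _ _); apply/funext => n.
by rewrite -expr2 sqr_sqrtr// (eigen_system_ge0 sys).
Qed.

End PositiveOperator.

End DiagonalOperators.

Section SingularValues.
Variables (R : realType) (H : completeNormedModType R[i]).
Variable dot : {dot H for Num.conj}.
Hypothesis dotE : hilbert_dot dot.

Lemma adjointE (C D : H -> H) : is_adjoint dot C D -> adjoint dot C = D.
Proof.
move=> CD; have CadjC : is_adjoint dot C (adjoint dot C).
  by apply: (@xgetPex _ (fun=> 0) [set B | is_adjoint dot C B]); exists D.
apply/funext => y; apply/eqP; rewrite -subr_eq0 -(dnorm_eq0 dot) linearBr /=.
by rewrite -CadjC -CD subrr.
Qed.

Variables C D : {linear H -> H}.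
Hypotheses (CD : is_adjoint dot C D) (cC : seq_compact C).
Hypothesis contD : continuous D.

Let DC u y : dot (D u) y = dot u (C y).
Proof. by rewrite dotC -CD -dotC. Qed.

Lemma abs_op_spec :
  [/\ bounded_op (abs_op dot C), selfadjoint dot (abs_op dot C),
      positive_op dot (abs_op dot C) &
      abs_op dot C \o abs_op dot C = D \o C].
Proof.
rewrite /abs_op (adjointE CD); have saDC : selfadjoint dot (D \o C).
  by move=> x y /=; rewrite DC CD.
have cDC := seq_compact_comp contD cC.
have posDC : positive_op dot (D \o C) by move=> x /=; rewrite DC dnorm_ge0.
have [e [l sys]] := eigen_system_ex dotE saDC cDC.
by have := sqrt_op_ex dotE saDC cDC posDC sys; exact: xgetPex.
Qed.

Let T : {linear H -> H} :=
  let: And4 bT _ _ _ := abs_op_spec in linear_pack bT.1.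
Let TE : T = abs_op dot C :> (H -> H).
Proof. by rewrite /T; case: abs_op_spec. Qed.

Lemma rnorm_abs_op x : rnorm (abs_op dot C x) = rnorm (C x).
Proof.
have [_ saT _ TT] := abs_op_spec; apply/eqP.
rewrite -(eqrXn2 (n := 2)) ?rnorm_ge0// -!(rdotxx dotE) /rdot -saT -DC.
by rewrite -[abs_op _ _ _]/((abs_op dot C \o abs_op dot C) x) TT.
Qed.

Let cT : seq_compact T.
Proof. by apply: seq_compact_dominated cC _ => x; rewrite TE rnorm_abs_op. Qed.

Lemma singular_value_eigen_system :
  exists f, eigen_system dot (abs_op dot C) f (singular_value dot C).
Proof.
rewrite /singular_value -TE; apply: lambda_plus_eigen_system => //.
by rewrite TE; case: abs_op_spec.
Qed.

Lemma singular_value_ge0 n : 0 <= singular_value dot C n.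
Proof.
by have [f sys] := singular_value_eigen_system; exact: eigen_system_ge0 sys n.
Qed.

Lemma singular_value_bound : exists f, forall n x, orth_prefix dot f n x ->
  rnorm (C x) <= singular_value dot C n * rnorm x.
Proof.
have [f sys] := singular_value_eigen_system; have [_ saT posT _] := abs_op_spec.
exists f => n x ox; rewrite -rnorm_abs_op -TE.
by apply: (positive_eigen_system_le dotE _ _ _ ox); rewrite TE.
Qed.

End SingularValues.

(** * Almost orthogonal sums *)

Lemma sum_tagged (V : nmodType) (I : finType) (n : I -> nat)
    (F : {l : I & 'I_(n l)} -> V) :
  \sum_p F p = \sum_l \sum_(i < n l) F (Tagged (fun l => 'I_(n l)) i).
Proof.
rewrite (sig_big_dep xpredT (fun _ _ => true)
  (fun l i => F (Tagged (fun l => 'I_(n l)) i))).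
by apply: eq_bigr => -[l i].
Qed.

Lemma card_tagged_ord (I : finType) (n : I -> nat) :
  #|{: {l : I & 'I_(n l)}}| = (\sum_l n l)%N.
Proof.
rewrite card_tagged sumnE big_map big_enum /=.
by under eq_bigr do rewrite card_ord.
Qed.

Lemma norm_sum_le_card (R : numDomainType) (I : finType) (F : I -> R) (c : R) :
  (forall i, `|F i| <= c) -> `|\sum_i F i| <= #|I|%:R * c.
Proof.
move=> Fc; apply: le_trans (ler_norm_sum _ _ _) _.
apply: le_trans (ler_sum _ (fun i _ => Fc i)) _.
by rewrite sumr_const mulr_natl.
Qed.

Lemma norm_sum_off_diagonal_le (R : numDomainType) (I : finType)
    (F : I -> I -> R) (c : R) :
  0 <= c -> (forall i j, i != j -> `|F i j| <= c) ->
  `|\sum_i \sum_j F i j - \sum_i F i i| <= #|I|%:R ^+ 2 * c.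
Proof.
move=> c0 Fc; rewrite -sumrB expr2 -mulrA; apply: norm_sum_le_card => i.
have -> : F i i = \sum_j if i == j then F i j else 0.
  by rewrite -big_mkcond (big_pred1 i)// => j; rewrite eq_sym.
rewrite -sumrB; apply: norm_sum_le_card => j.
by have [->|ij] := eqVneq; rewrite ?subrr ?normr0// subr0; exact: Fc.
Qed.

Section AlmostOrthogonalSum.
Variables (R : realType) (H : completeNormedModType R[i]).
Variable dot : {dot H for Num.conj}.
Local Notation rdot := (rdot dot).

Lemma orth_combination (I J : finType) (u : I -> H) (v : J -> H) :
  (#|J| < #|I|)%N ->
  exists2 c : I -> R[i], (exists i, c i != 0) & orth dot v (\sum_i c i *: u i).
Proof.
move=> /(nontrivial_solution (fun i j => dot (u i) (v j)))[c c0 cv].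
exists c => // j; rewrite linear_sumlz -[RHS](cv j).
by apply: eq_bigr => i _; rewrite /= dotZl.
Qed.

Variables (I : finType) (A : I -> {linear H -> H}).

Definition op_sum x := \sum_l A l x.

Lemma op_sum_linear : linear op_sum.
Proof.
move=> a x y; rewrite /op_sum scaler_sumr -big_split /=.
by apply: eq_bigr => l _; rewrite linearP.
Qed.

HB.instance Definition _ :=
  GRing.isLinear.Build R[i] H H *:%R op_sum op_sum_linear.

Lemma orth_combination_family (J : finType) (F : J -> H) (E : nat -> H)
    (N : nat) (e : I -> nat -> H) (n : I -> nat) :
  (N + #|I| * #|J| < \sum_l n l)%N ->
  exists c : forall l, 'I_(n l) -> R[i], let y l := \sum_i c l i *: e l i in
  [/\ exists l i, c l i != 0, forall l, orth dot F (y l) &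
      orth_prefix dot E N (\sum_l A l (y l))].
Proof.
move=> dim; pose J' : finType := ('I_N + I * J)%type.
pose w (p : {l : I & 'I_(n l)}) (j : J') : R[i] :=
  let v := e (tag p) (tagged p) in match j with
  | inl r => dot (A (tag p) v) (E r)
  | inr (l, r) => if tag p == l then dot v (F r) else 0
  end.
have [|c [[l i] c0] cw] := nontrivial_solution w.
  by rewrite card_sum card_prod card_ord card_tagged_ord.
exists (fun l i => c (Tagged (fun l => 'I_(n l)) i)) => y; split.
- by exists l, i.
- move=> k r; have := cw (inr (k, r)).
  rewrite sum_tagged (bigD1 k)//= [X in _ + X]big1 => [|k' kk'].
    rewrite addr0 eqxx => sum0; rewrite /y linear_sumlz -[RHS]sum0.
    by apply: eq_bigr => j _; rewrite /= dotZl.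
  by rewrite big1// => j _; rewrite (negPf kk') mulr0.
- move=> r; rewrite linear_sumlz -[RHS](cw (inl r)) sum_tagged.
  apply: eq_bigr => k _; rewrite /y linear_sum linear_sumlz.
  by apply: eq_bigr => j _; rewrite linearZ /= dotZl.
Qed.

Hypothesis dotE : hilbert_dot dot.
Hypothesis saA : forall l, selfadjoint dot (A l).

Section CrossTerms.
Variables (y : I -> H) (t W b k : R).
Let x := \sum_l A l (y l).
Let T := \sum_l rnorm (A l (y l)) ^+ 2.
Let q : R := #|I|%:R ^+ 2.

Hypotheses (t_gt0 : 0 < t) (W_ge0 : 0 <= W) (b_ge0 : 0 <= b).
Hypothesis le_yW : forall l, t * rnorm (y l) <= W.
Hypothesis cross_le : forall i j, i != j -> rnorm (A i (A j (y j))) <= b.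
Hypothesis le_qb : q * b <= k * t * W.

Lemma rnorm_sqr_sum_almost_orthogonal : `|rnorm x ^+ 2 - T| <= k * W ^+ 2.
Proof.
pose F i j := rdot (A i (y i)) (A j (y j)).
have -> : rnorm x ^+ 2 = \sum_i \sum_j F i j.
  rewrite -(rdotxx dotE) /x rdot_suml; apply: eq_bigr => i _.
  by rewrite rdot_sumr.
have -> : T = \sum_i F i i by apply: eq_bigr => i _; rewrite -(rdotxx dotE).
have Y0 : 0 <= W / t by rewrite divr_ge0// ltW.
apply: le_trans (norm_sum_off_diagonal_le (F := F) (c := b * (W / t)) _ _) _.
- exact: mulr_ge0.
- move=> i j ij; rewrite /F -(selfadjoint_rdot (@saA j)).
  apply: le_trans (rdot_CauchySchwarz dotE _ _) _.
  apply: ler_pM; rewrite ?rnorm_ge0//.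
    by apply: cross_le; rewrite eq_sym.
  by rewrite ler_pdivlMr// mulrC.
have -> : k * W ^+ 2 = k * t * W * (W / t) by field; rewrite gt_eqF.
by rewrite [leLHS]mulrA ler_wpM2r.
Qed.

Lemma form_sum_almost_orthogonal :
  rnorm x ^+ 2 <= 4 * W ^+ 2 -> T <= 4 * W ^+ 2 ->
  `|rdot (op_sum x) x - \sum_l rdot (A l (A l (y l))) (A l (y l))|
    <= 4 * k * t * W ^+ 2.
Proof.
move=> lexW leTW; have W2 : 0 <= 2 * W by rewrite mulr_ge0.
have sqr_le u : rnorm u ^+ 2 <= 4 * W ^+ 2 -> rnorm u <= 2 * W.
  rewrite (_ : 4 * W ^+ 2 = (2 * W) ^+ 2); last by ring.
  by rewrite rnorm_le_sqr.
have le_xl l : rnorm (A l (y l)) <= 2 * W.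
  apply/sqr_le/(le_trans _ leTW); rewrite /T (bigD1 l)//= lerDl.
  by apply: sumr_ge0 => j _; exact: sqr_ge0.
pose F i j := rdot (A i (A j (y j))) x.
pose G i j := rdot (A i (A i (y i))) (A j (y j)).
have -> : rdot (op_sum x) x = \sum_i \sum_j F i j.
  rewrite rdot_suml; apply: eq_bigr => i _.
  by rewrite {1}/x linear_sum rdot_suml.
have FG : \sum_i F i i = \sum_i \sum_j G i j.
  by apply: eq_bigr => i _; rewrite /F /x rdot_sumr.
have le_bW : q * (b * (2 * W)) <= 2 * k * t * W ^+ 2.
  have -> : 2 * k * t * W ^+ 2 = k * t * W * (2 * W) by ring.
  by rewrite [leLHS]mulrA ler_wpM2r.
have b2W : 0 <= b * (2 * W) by exact: mulr_ge0.
have leF : `|\sum_i \sum_j F i j - \sum_i F i i| <= q * (b * (2 * W)).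
  apply: norm_sum_off_diagonal_le => // i j ij.
  apply: le_trans (rdot_CauchySchwarz dotE _ _) _.
  by apply: ler_pM; rewrite ?rnorm_ge0 ?cross_le//; exact: sqr_le.
have leG : `|\sum_i \sum_j G i j - \sum_i G i i| <= q * (b * (2 * W)).
  apply: norm_sum_off_diagonal_le => // i j ij.
  rewrite /G (selfadjoint_rdot (@saA i)) mulrC.
  apply: le_trans (rdot_CauchySchwarz dotE _ _) _.
  by apply: ler_pM; rewrite ?rnorm_ge0 ?cross_le.
move: leF leG; rewrite FG !ler_norml; lra.
Qed.

End CrossTerms.

Variables (J : finType) (F : J -> H) (d t r : R).
Hypotheses (d_ge0 : 0 <= d) (t_gt0 : 0 < t) (r01 : 0 <= r < 1).
Hypothesis cross_le : forall i j, i != j ->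
  forall y, orth dot F y -> rnorm (A i (A j y)) <= d * rnorm y.
Hypothesis d_small : #|I|%:R ^+ 2 * d <= (1 - r) / 6 * t ^+ 2.
Variables (e : I -> nat -> H) (lam : I -> nat -> R).
Variables (E : nat -> H) (Lam : nat -> R).
Hypothesis sys : forall l, eigen_system dot (A l) (e l) (lam l).
Hypothesis Sys : eigen_system dot op_sum E Lam.

Let k := (1 - r) / 6.

Let k_ge0 : 0 <= k.
Proof. by move: r01 => /andP[_ r1]; rewrite divr_ge0// subr_ge0 ltW. Qed.

Let k_le1 : k <= 1.
Proof. by move: r01 => /andP[r0 _]; rewrite ler_pdivrMr//; lra. Qed.

Lemma norm_form_sum_almost_orthogonal (y : I -> H) (W : R)
    (x := \sum_l A l (y l)) (T := \sum_l rnorm (A l (y l)) ^+ 2) :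
  0 <= W -> (forall l, orth dot F (y l)) -> (forall l, t * rnorm (y l) <= W) ->
  W ^+ 2 = T \/ W ^+ 2 = rnorm x ^+ 2 ->
  `|rnorm x ^+ 2 - T| <= k * W ^+ 2 /\
  `|rdot (op_sum x) x - \sum_l rdot (A l (A l (y l))) (A l (y l))|
    <= 4 * k * t * W ^+ 2.
Proof.
move=> W0 yF le_yW WE; have Wt0 : 0 <= W / t by rewrite divr_ge0// ltW.
have cross i j : i != j -> rnorm (A i (A j (y j))) <= d * (W / t).
  move=> ij; apply: le_trans (cross_le ij (yF j)) _.
  by rewrite ler_wpM2l// ler_pdivlMr// mulrC.
have b0 : 0 <= d * (W / t) by exact: mulr_ge0.
have le_qb : #|I|%:R ^+ 2 * (d * (W / t)) <= k * t * W.
  have -> : k * t * W = k * t ^+ 2 * (W / t) by field; rewrite gt_eqF.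
  by rewrite [leLHS]mulrA ler_wpM2r.
have near_T := rnorm_sqr_sum_almost_orthogonal t_gt0 W0 b0 le_yW cross le_qb.
split=> //; have kW : k * W ^+ 2 <= W ^+ 2 by rewrite ler_piMl ?sqr_ge0.
move: near_T; rewrite -/x -/T ler_norml => /andP[? ?].
by apply: (form_sum_almost_orthogonal W0 b0 cross le_qb); rewrite -/x -/T;
  case: WE => WE; lra.
Qed.

Lemma eigenvalue_sum_ge (n : I -> nat) N :
  (forall l i, (i < n l)%N -> t <= lam l i) ->
  (N + #|I| * #|J| < \sum_l n l)%N -> r * t <= Lam N.
Proof.
move=> le_t dim.
have [c [[l0 c0] yF xE]] := orth_combination_family F E e dim.
pose y l := \sum_i c l i *: e l i.
pose x := \sum_l A l (y l); pose T := \sum_l rnorm (A l (y l)) ^+ 2.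
have le_t' l (i : 'I_(n l)) : t <= lam l i by exact: le_t.
have normA l := eigen_span_norm_ge dotE (sys l) (c l) t_gt0 (le_t' l).
have formA l := eigen_span_form_ge dotE (sys l) (c l) t_gt0 (le_t' l).
have le_T l : rnorm (A l (y l)) ^+ 2 <= T.
  by rewrite /T (bigD1 l)//= lerDl; apply: sumr_ge0 => j _; exact: sqr_ge0.
have T0 : 0 < T.
  apply: lt_le_trans (le_T l0); rewrite exprn_gt0//.
  apply: lt_le_trans (normA l0).
  by rewrite mulr_gt0// rnorm_gt0 (eigen_span_neq0 (sys l0) t_gt0).
have [||l||near_T near_form] := @norm_form_sum_almost_orthogonal y (Num.sqrt T).
- exact: sqrtr_ge0.
- exact: yF.
- apply: le_trans (normA l) _; rewrite rnorm_le_sqr ?sqrtr_ge0//.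
  by rewrite sqr_sqrtr ?(ltW T0).
- by left; rewrite sqr_sqrtr ?(ltW T0).
move: near_T near_form; rewrite -/x -/T sqr_sqrtr ?(ltW T0)// !ler_norml.
move=> /andP[_ norm_x] /andP[form_x _].
have form_ge : t * T <= \sum_l rdot (A l (A l (y l))) (A l (y l)).
  by rewrite mulr_sumr; apply: ler_sum => l _; exact: formA.
have form_le : rdot (op_sum x) x <= Lam N * ((1 + k) * T).
  apply: le_trans (eigen_system_form_le Sys xE) _.
  by apply: ler_wpM2l (eigen_system_ge0 Sys N) _ _ _; lra.
have k1 : 0 < (1 + k) * T by rewrite mulr_gt0// ltr_wpDr.
rewrite -(ler_pM2r k1); apply: le_trans form_le.
have : r * (1 + k) <= 1 - 4 * k by rewrite /k; move: r01 => /andP[? ?]; nra.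
move=> /(ler_wpM2r (mulr_ge0 (ltW t_gt0) (ltW T0))); lra.
Qed.

Lemma eigenvalue_sum_lt (n : I -> nat) :
  (forall l, lam l (n l) <= r * t) -> Lam (\sum_l n l + #|J|)%N < t.
Proof.
move=> le_rt; set N := (_ + _)%N; rewrite ltNge; apply/negP => ge_t.
pose v (p : {l : I & 'I_(n l)} + J) : H := match p with
  | inl q => e (tag q) (tagged q : 'I_(n (tag q)))
  | inr j => F j
  end.
have [|c c0 yv] := @orth_combination 'I_N.+1 _ (fun i => E i) v.
  by rewrite card_sum card_tagged_ord card_ord.
have ge_t' (i : 'I_N.+1) : t <= Lam i.
  by apply: le_trans ge_t (eigen_system_nonincr dotE Sys _); rewrite -ltnS.
have y0 := eigen_span_neq0 Sys t_gt0 ge_t' c0.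
have normA := eigen_span_norm_ge dotE Sys c t_gt0 ge_t'.
have formA := eigen_span_form_ge dotE Sys c t_gt0 ge_t'.
move: (\sum_i _) yv y0 normA formA => y yv y0 normA formA; pose x := op_sum y.
have W0 : 0 < rnorm x by apply: lt_le_trans normA; rewrite mulr_gt0 ?rnorm_gt0.
have [|_ j|_ //||near_T near_form] :=
    @norm_form_sum_almost_orthogonal (fun=> y) (rnorm x).
- exact: ltW.
- exact: (yv (inr j)).
- by right.
move: near_T near_form; rewrite -/(op_sum y) -/x; set T := \sum_l _.
rewrite !ler_norml => /andP[norm_x _] /andP[_ form_x].
have form_le : \sum_l rdot (A l (A l y)) (A l y) <= r * t * T.
  rewrite mulr_sumr; apply: ler_sum => l _.
  apply: le_trans (ler_wpM2r (sqr_ge0 _) (le_rt l)).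
  apply: eigen_system_form_le (sys l) _ _ _.
  apply: orth_eigenvectors => // i; last exact: (yv (inl (Tagged _ i))).
  by exists (lam l i); exact: eigen_system_eigen (sys l) i.
have rt0 : 0 <= r * t by rewrite mulr_ge0 ?(ltW t_gt0)//; case/andP: r01.
have leT : r * t * T <= r * t * ((1 + k) * rnorm x ^+ 2).
  by rewrite ler_wpM2l//; lra.
have : r * (1 + k) + 4 * k < 1 by rewrite /k; move: r01 => /andP[? ?]; nra.
rewrite -(ltr_pM2r (mulr_gt0 t_gt0 (exprn_gt0 2 W0))).
move: formA; rewrite -/(op_sum y) -/x; lra.
Qed.

End AlmostOrthogonalSum.

(** * Asymptotics *)

Section ExtendedReals.
Variable R : realType.

Lemma limf_esup_le (T : choiceType) (X : filteredType T) (F : set_system X)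
    (u : X -> \bar R) (K : \bar R) :
  (\forall x \near F, (u x <= K)%E) -> (limf_esup u F <= K)%E.
Proof.
move=> uK; apply: ge_ereal_inf; eexists; first by exists [set x | (u x <= K)%E].
by apply: ge_ereal_sup => _ [x uxK <-].
Qed.

Lemma limf_esup_lt (T : choiceType) (X : filteredType T) (F : set_system X)
    {FF : Filter F} (u : X -> \bar R) (K : \bar R) :
  (limf_esup u F < K)%E -> \forall x \near F, (u x < K)%E.
Proof.
move=> /ereal_inf_lt[_ [V FV <-] VK]; apply: filterS FV => x Vx.
by apply: le_lt_trans VK; apply: ereal_sup_ubound; exists x.
Qed.

Lemma limn_einf_ge (u : nat -> \bar R) (K : \bar R) :
  (\forall n \near \oo, (K <= u n)%E) -> (K <= limn_einf u)%E.
Proof.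
move=> uK; rewrite leeNr; apply: limf_esup_le.
by apply: filterS uK => n; rewrite leeN2.
Qed.

Lemma limn_einf_gt (u : nat -> \bar R) (K : \bar R) :
  (K < limn_einf u)%E -> \forall n \near \oo, (K < u n)%E.
Proof.
by rewrite lteNr => /limf_esup_lt; apply: filterS => n; rewrite lteN2.
Qed.

Variables (I : finType) (x : I -> \bar R) (y : \bar R).
Hypothesis x_ge0 : forall i, (0 <= x i)%E.

Let fin_or_pinfty : (forall i, x i \is a fin_num) \/ exists i, x i = +oo%E.
Proof.
have [[i xi]|finx] := pselect (exists i, x i = +oo%E); first by right; exists i.
left=> i; rewrite ge0_fin_numE// ltey.
by apply: contra_notN finx => /eqP; exists i.
Qed.

Let sum_fine : (forall i, x i \is a fin_num) ->
  (\sum_i x i)%E = (\sum_i fine (x i))%:E.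
Proof.
by move=> finx; rewrite -sumEFin; apply: eq_bigr => i _; rewrite fineK.
Qed.

Let cardS_gt0 : 0 < #|I|%:R + 1 :> R.
Proof. by rewrite ltr_wpDl. Qed.

Lemma lee_sum_of_gt :
  (forall (D : I -> R) (K : R), (forall i, (x i < (D i)%:E)%E) ->
    \sum_i D i < K -> (y <= K%:E)%E) ->
  (y <= \sum_i x i)%E.
Proof.
move=> le_y; have [finx|[i xi]] := fin_or_pinfty; last first.
  suff /eqP -> : (\sum_i x i == +oo)%E by exact: leey.
  rewrite esum_eqy => [|j _]; last first.
    by rewrite gt_eqF// (lt_le_trans _ (x_ge0 j))// ltNy0.
  by apply/existsP; exists i; rewrite xi eqxx.
rewrite sum_fine//; apply/lee_addgt0Pr => e e0; rewrite -EFinD.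
pose h := e / (#|I|%:R + 1).
have hE : (#|I|%:R + 1) * h = e by rewrite mulrC divfK ?gt_eqF.
have h0 : 0 < h by rewrite divr_gt0.
apply: (le_y (fun i => fine (x i) + h)).
  by move=> i; rewrite -[ltLHS]fineK// lte_fin ltrDl.
by rewrite big_split sumr_const /= -mulr_natl; lra.
Qed.

Lemma sum_lee_of_lt :
  (forall (d : I -> R) (K : R), (forall i, ((d i)%:E < x i)%E) ->
    K < \sum_i d i -> (K%:E <= y)%E) ->
  (\sum_i x i <= y)%E.
Proof.
move=> ge_y; have [finx|[i0 xi0]] := fin_or_pinfty.
  rewrite sum_fine//; apply/lee_subgt0Pr => e e0; rewrite -EFinB.
  pose h := e / (#|I|%:R + 1).
  have hE : (#|I|%:R + 1) * h = e by rewrite mulrC divfK ?gt_eqF.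
  have h0 : 0 < h by rewrite divr_gt0.
  apply: (ge_y (fun i => fine (x i) - h)).
    by move=> i; rewrite -[ltRHS]fineK// lte_fin ltrBlDr ltrDl.
  by rewrite sumrB sumr_const -mulr_natl; lra.
suff -> : y = +oo%E by exact: leey.
apply/eqyP => K _.
apply: (ge_y (fun i => (if i == i0 then K + #|I|%:R + 1 else 0) - 1)).
  move=> i; have [->|_] := eqVneq; first by rewrite xi0 ltry.
  by apply: lt_le_trans (x_ge0 i); rewrite lte_fin sub0r ltrN10.
rewrite sumrB -big_mkcond big_pred1_eq sumr_const; lra.
Qed.

End ExtendedReals.

Section PowerDecay.
Variable R : realType.
Implicit Types (u : nat -> R) (p q x b c : R).

Definition level p x : R := x^-1 `^ p^-1.

Lemma level_gt0 p x : 0 < x -> 0 < level p x.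
Proof. by move=> x0; rewrite powR_gt0// invr_gt0. Qed.

Lemma level_powR p x : 0 < p -> 0 < x -> level p x `^ p = x^-1.
Proof.
by move=> p0 x0; rewrite -powRrM mulVf ?gt_eqF// powRr1// invr_ge0 ltW.
Qed.

Lemma ler_powR_cancel p x y : 0 < p -> 0 <= x -> 0 <= y ->
  x `^ p <= y `^ p -> x <= y.
Proof.
move=> p0 x0 y0; apply: contra_le => yx.
by apply: gt0_ltr_powR; rewrite ?nnegrE.
Qed.

Lemma near_pinfty_scaled_nat (P : R -> Prop) c : 0 < c ->
  (\forall x \near +oo, P x) -> \forall n \near \oo, P (n.+1%:R * c).
Proof.
move=> c0 [M [_ MP]]; near=> n; apply: MP.
rewrite -ltr_pdivrMr// -natr1 ltr_wpDr//; near: n; exact: nbhs_infty_gtr.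
Unshelve. all: by end_near. Qed.

Lemma near_pinfty_truncn (P : nat -> Prop) c : 0 < c ->
  (\forall n \near \oo, P n) -> \forall x \near +oo, P (Num.truncn (c * x)).
Proof.
move=> c0 [N _ NP]; near=> x; apply: NP; rewrite /= truncn_ge_nat; last first.
  by rewrite mulr_ge0 ?ltW//; near: x; exact: nbhs_pinfty_gt.
rewrite mulrC -ler_pdivrMr//; near: x; exact: nbhs_pinfty_ge.
Unshelve. all: by end_near. Qed.

Lemma power_decay_le u q c h :
  0 < q -> 0 < c -> 0 <= h -> (forall n, 0 <= u n) ->
  (\forall n \near \oo, n.+1%:R * u n `^ q <= c * h `^ q) ->
  \forall x \near +oo, u (Num.truncn (c * x)) <= h * level q x.
Proof.
move=> q0 c0 h0 u0 /(near_pinfty_truncn c0) decay; near=> x.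
have x0 : 0 < x by near: x; exact: nbhs_pinfty_gt.
have : (Num.truncn (c * x)).+1%:R * u (Num.truncn (c * x)) `^ q <= c * h `^ q.
  by near: x.
set n := Num.truncn _ => decay_x; apply: (ler_powR_cancel q0) => //.
  by rewrite mulr_ge0// ltW// level_gt0.
rewrite powRM ?(ltW (level_gt0 q x0))// level_powR// ler_pdivlMr//.
rewrite -(ler_pM2l c0) [_ * x]mulrC mulrA; apply: le_trans decay_x.
by rewrite ler_wpM2r ?powR_ge0// ltW// truncnS_gt.
Unshelve. all: by end_near. Qed.

Lemma power_decay_ge u p d : 0 < p -> (forall n, 0 <= u n) ->
  {homo u : m n / (m <= n)%N >-> n <= m} ->
  (\forall n \near \oo, d <= n.+1%:R * u n `^ p) ->
  \forall x \near +oo, forall i, (i < Num.truncn (d * x))%N -> level p x <= u i.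
Proof.
move=> p0 u0 u_dec decay; have [d0|d0] := leP d 0.
  near=> x; have x0 : 0 < x by near: x; exact: nbhs_pinfty_gt.
  have dx : d * x < 1.
    by apply: le_lt_trans ltr01; rewrite mulr_le0_ge0 ?(ltW x0).
  by move=> i; rewrite truncn_gt_nat => /le_lt_trans/(_ dx); rewrite ltrn1.
have near_pred : \forall x \near +oo, d <= (Num.truncn (d * x)).-1.+1%:R *
    u (Num.truncn (d * x)).-1 `^ p.
  apply: (near_pinfty_truncn
    (P := fun n => d <= n.-1.+1%:R * u n.-1 `^ p)) => //.
  exact: near_inftyS.
near=> x; have x0 : 0 < x by near: x; exact: nbhs_pinfty_gt.
have : d <= (Num.truncn (d * x)).-1.+1%:R * u (Num.truncn (d * x)).-1 `^ p.
  by near: x.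
set n := Num.truncn _ => decay_x i ltin.
have n0 : (0 < n)%N by exact: leq_ltn_trans ltin.
have lein : (i <= n.-1)%N by rewrite -ltnS prednK.
apply: le_trans (u_dec _ _ lein); apply: (ler_powR_cancel p0) => //.
  by rewrite ltW// level_gt0.
rewrite level_powR// -(ler_pM2r x0) mulVf ?gt_eqF// -(ler_pM2l d0) mulr1.
apply: le_trans (_ : n%:R * u n.-1 `^ p <= _).
  by rewrite -{1}(prednK n0).
rewrite mulrA mulrAC ler_wpM2r ?powR_ge0//.
by have /andP[] := truncn_itv (mulr_ge0 (ltW d0) (ltW x0)).
Unshelve. all: by end_near. Qed.

Lemma sum_truncn_ge (I : finType) (d : I -> R) x :
  \sum_i d i * x - #|I|%:R <= (\sum_i Num.truncn (d i * x))%:R.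
Proof.
rewrite natr_sum lerBlDr -sumr_const -big_split /=.
by apply: ler_sum => i _; rewrite natr1 ltW// truncnS_gt.
Qed.

Lemma sum_truncn_le (I : finType) (d : I -> R) x : (forall i, 0 <= d i * x) ->
  (\sum_i Num.truncn (d i * x))%:R <= \sum_i d i * x.
Proof.
by move=> dx; rewrite natr_sum; apply: ler_sum => i _; rewrite truncn_le.
Qed.

Lemma near_sum_truncn_gt (I : finType) (d : I -> R) c K (m : nat) : 0 <= c ->
  K + m%:R * c < \sum_i d i ->
  \forall x \near +oo, forall N : nat, N%:R <= K * x ->
    (N + m * Num.truncn (c * x) < \sum_i Num.truncn (d i * x))%N.
Proof.
set S := \sum_i d i => c0 KS; near=> x => N NK.
have x0 : 0 < x by near: x; exact: nbhs_pinfty_gt.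
have le_cx : m%:R * (Num.truncn (c * x))%:R <= m%:R * (c * x) :> R.
  by rewrite ler_wpM2l// truncn_le mulr_ge0// ltW.
have lt_x : #|I|%:R < (S - (K + m%:R * c)) * x.
  rewrite mulrC -ltr_pdivrMr ?subr_gt0//; near: x; apply: nbhs_pinfty_gt.
  exact: num_real.
rewrite -(ltr_nat R) natrD natrM; apply: lt_le_trans (sum_truncn_ge d x).
rewrite -mulr_suml -/S; lra.
Unshelve. all: by end_near. Qed.

Lemma near_sum_truncn_le (I : finType) (d : I -> R) c K (m : nat) : 0 <= c ->
  (forall i, 0 <= d i) -> \sum_i d i + m%:R * c < K ->
  \forall x \near +oo, forall N : nat, K * x <= N.+1%:R ->
    (\sum_i Num.truncn (d i * x) + m * Num.truncn (c * x) <= N)%N.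
Proof.
set S := \sum_i d i => c0 d0 SK; near=> x => N KN.
have x0 : 0 < x by near: x; exact: nbhs_pinfty_gt.
have le_cx : m%:R * (Num.truncn (c * x))%:R <= m%:R * (c * x) :> R.
  by rewrite ler_wpM2l// truncn_le mulr_ge0// ltW.
have lt_x : 1 < (K - (S + m%:R * c)) * x.
  rewrite mulrC -ltr_pdivrMr ?subr_gt0//; near: x; apply: nbhs_pinfty_gt.
  exact: num_real.
have := sum_truncn_le (fun i => mulr_ge0 (d0 i) (ltW x0)).
rewrite -(ler_nat R) natrD natrM -mulr_suml -/S; move: KN; rewrite -natr1; lra.
Unshelve. all: by end_near. Qed.

Lemma natmul_lt_ex (m : nat) b : 0 < b -> exists2 c, 0 < c & m%:R * c < b.
Proof.
move=> b0; have m1 : 0 < m%:R + 1 :> R by rewrite ltr_wpDl.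
exists (b / (m%:R + 1)); first exact: divr_gt0.
by rewrite mulrA ltr_pdivrMr// mulrC ltr_pM2l// ltrDl.
Qed.

Lemma powR_gt_ex p b : 0 < p -> 0 <= b < 1 -> exists2 r, 0 < r < 1 & b < r `^ p.
Proof.
move=> p0 /andP[b0 b1]; pose a := (b + 1) / 2.
have ab : b < a by rewrite /a; lra.
have a0 : 0 < a by exact: le_lt_trans ab.
have a1 : a < 1 by rewrite /a; lra.
have rp : (a `^ p^-1) `^ p = a by rewrite -powRrM mulVf ?gt_eqF// powRr1// ltW.
exists (a `^ p^-1); last by rewrite rp.
rewrite powR_gt0//= ltNge; apply/negP => /(ge0_ler_powR (ltW p0)).
by rewrite !nnegrE rp powR1 ler01 powR_ge0 => /(_ isT isT); rewrite leNgt a1.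
Qed.

End PowerDecay.

Section DeltaPositivity.
Variables (R : realType) (H : completeNormedModType R[i]).
Implicit Types (B : H -> H) (p : R) (s : bool).

Lemma Delta_ge0 p s B : (0 <= Delta p s B)%E.
Proof.
apply: limf_esup_ge0 => [|n]; first exact: filter_not_empty.
by rewrite lee_fin mulr_ge0 ?powR_ge0.
Qed.

Lemma delta_ge0 p s B : (0 <= delta p s B)%E.
Proof.
by apply: limn_einf_ge; apply: nearW => n; rewrite lee_fin mulr_ge0 ?powR_ge0.
Qed.

End DeltaPositivity.

Section PositiveSpectrum.
Variables (R : realType) (H : completeNormedModType R[i]).
Variable dot : {dot H for Num.conj}.
Hypothesis dotE : hilbert_dot dot.
Variables (I : finType) (A : I -> {linear H -> H}) (p : R).
Hypotheses (p_gt0 : 0 < p) (cA : forall l, seq_compact (A l))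
  (saA : forall l, selfadjoint dot (A l)).
Hypothesis products_S0 : forall i j, i != j ->
  (n.+1%:R * singular_value dot (A i \o A j) n `^ (p / 2) : R)
    @[n --> \oo] --> (0 : R).

Let lam l := lambda_plus (A l).
Let Lam := lambda_plus (op_sum A).

Let is_adjoint_product i j : is_adjoint dot (A i \o A j) (A j \o A i).
Proof. by move=> x y /=; rewrite !saA. Qed.

Let seq_compact_product i j : seq_compact (A i \o A j).
Proof. by apply: seq_compact_comp => //; exact: seq_compact_continuous. Qed.

Let continuous_product i j : continuous (A i \o A j).
Proof. exact: seq_compact_continuous (@seq_compact_product i j). Qed.

Let product_singular_value_ge0 i j n : 0 <= singular_value dot (A i \o A j) n.
Proof.
exact: (singular_value_ge0 dotE (@is_adjoint_product i j)
  (@seq_compact_product i j) (@continuous_product j i)).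
Qed.

Lemma products_le_off_orth m : exists F : I * I * 'I_m -> H, forall i j y,
  orth dot F y ->
  rnorm (A i (A j y)) <= singular_value dot (A i \o A j) m * rnorm y.
Proof.
have /choice[f fP] : forall ij : I * I, exists f, forall n x,
    orth_prefix dot f n x -> rnorm (A ij.1 (A ij.2 x)) <=
    singular_value dot (A ij.1 \o A ij.2) n * rnorm x.
  move=> [i j]; exact: (singular_value_bound dotE (@is_adjoint_product i j)
    (@seq_compact_product i j) (@continuous_product j i)).
exists (fun q => f q.1 (val q.2)) => i j y oy; apply: (fP (i, j)) => r.
exact: (oy (i, j, r)).
Qed.

Lemma near_products_small (h c : R) : 0 < h -> 0 < c ->
  \forall x \near +oo, exists F : I * I * 'I_(Num.truncn (c * x)) -> H,
    forall i j, i != j -> forall y, orth dot F y ->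
    rnorm (A i (A j y)) <= h * level p x ^+ 2 * rnorm y.
Proof.
move=> h0 c0; have p2 : 0 < p / 2 by rewrite divr_gt0.
have level2 x : 0 <= x -> level (p / 2) x = level p x ^+ 2.
  by move=> x0; rewrite /level -powR_mulrn ?powR_ge0// -powRrM invf_div mulrC.
have near_sv : \forall x \near +oo, forall i j, i != j ->
    singular_value dot (A i \o A j) (Num.truncn (c * x)) <= h * level (p / 2) x.
  apply: filter_forall => i; apply: filter_forall => j.
  have [_|ij] := eqVneq i j; first exact: nearW.
  have bound : 0 < c * h `^ (p / 2) by rewrite mulr_gt0// powR_gt0.
  have sv0 := @product_singular_value_ge0 i j.
  apply: filterS (power_decay_le p2 c0 (ltW h0) sv0 _); first by [].
  have /cvgr_lt/(_ _ bound) := products_S0 ij.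
  by apply: filterS => n; exact: ltW.
near=> x; have [F FP] := products_le_off_orth (Num.truncn (c * x)); exists F.
have sv_x : forall i j, i != j ->
    singular_value dot (A i \o A j) (Num.truncn (c * x)) <= h * level (p / 2) x.
  by near: x.
move=> i j ij y oy; apply: le_trans (FP i j y oy) _.
rewrite ler_wpM2r ?rnorm_ge0// -level2; first exact: sv_x.
by near: x; exact: nbhs_pinfty_ge.
Unshelve. all: by end_near. Qed.

Let eigA l : exists e, eigen_system dot (A l) e (lam l).
Proof. exact: lambda_plus_eigen_system. Qed.

Let selfadjoint_op_sum : selfadjoint dot (op_sum A).
Proof.
move=> x y; rewrite /op_sum linear_sumlz linear_sumr.
by apply: eq_bigr => l _; exact: saA.
Qed.

Let eig_sum : exists E, eigen_system dot (op_sum A) E Lam.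
Proof. by apply: lambda_plus_eigen_system => //; exact: seq_compact_sum. Qed.

Let smallness (r : R) := (1 - r) / 6 / (#|I|%:R ^+ 2 + 1).

Let smallness_gt0 r : r < 1 -> 0 < smallness r.
Proof. by move=> r1; rewrite !divr_gt0 ?subr_gt0// ltr_wpDl ?sqr_ge0. Qed.

Let smallness_le r t : r < 1 ->
  #|I|%:R ^+ 2 * (smallness r * t ^+ 2) <= (1 - r) / 6 * t ^+ 2.
Proof.
move=> r1; rewrite mulrA ler_wpM2r ?sqr_ge0// mulrC /smallness mulrAC.
rewrite ler_pdivrMr.
  by rewrite ler_wpM2l ?lerDl// divr_ge0// subr_ge0 ltW.
by rewrite ltr_wpDl ?sqr_ge0.
Qed.

Lemma near_lambda_sum_ge (r c : R) (d : I -> R) : 0 < r < 1 -> 0 < c ->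
  (forall l, \forall n \near \oo, d l <= n.+1%:R * lam l n `^ p) ->
  \forall x \near +oo, forall N : nat,
    (N + #|I| * (#|I| * #|I|) * Num.truncn (c * x) <
      \sum_l Num.truncn (d l * x))%N ->
    r * level p x <= Lam N.
Proof.
move=> /andP[r0 r1] c0 decay.
have [e sys] := choice eigA; have [E Sys] := eig_sum.
have near_le : \forall x \near +oo, forall l i,
    (i < Num.truncn (d l * x))%N -> level p x <= lam l i.
  apply: filter_forall => l; apply: power_decay_ge => //.
    exact: eigen_system_ge0 (sys l).
  exact: eigen_system_nonincr (sys l).
have near_small := near_products_small (smallness_gt0 r1) c0.
near=> x => N dim; have x0 : 0 < x by near: x; exact: nbhs_pinfty_gt.
have t0 := level_gt0 p x0.
have [F FP] : exists F : I * I * 'I_(Num.truncn (c * x)) -> H,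
    forall i j, i != j -> forall y, orth dot F y ->
    rnorm (A i (A j y)) <= smallness r * level p x ^+ 2 * rnorm y by near: x.
apply: (eigenvalue_sum_ge dotE saA _ t0 _ FP (smallness_le _ r1) sys Sys
  (n := fun l => Num.truncn (d l * x))).
- by rewrite mulr_ge0 ?sqr_ge0// ltW// smallness_gt0.
- by rewrite (ltW r0).
- by near: x.
by rewrite !card_prod card_ord mulnA.
Unshelve. all: by end_near. Qed.

Lemma near_lambda_sum_lt (r c : R) (d : I -> R) : 0 < r < 1 -> 0 < c ->
  (forall l, 0 < d l) ->
  (forall l, \forall n \near \oo, n.+1%:R * lam l n `^ p <= d l * r `^ p) ->
  \forall x \near +oo,
    Lam (\sum_l Num.truncn (d l * x) + #|I| * #|I| * Num.truncn (c * x))%N <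
    level p x.
Proof.
move=> /andP[r0 r1] c0 d0 decay.
have [e sys] := choice eigA; have [E Sys] := eig_sum.
have near_le : \forall x \near +oo, forall l,
    lam l (Num.truncn (d l * x)) <= r * level p x.
  apply: filter_forall => l; apply: power_decay_le => //; first exact: ltW.
  exact: eigen_system_ge0 (sys l).
have near_small := near_products_small (smallness_gt0 r1) c0.
near=> x; have x0 : 0 < x by near: x; exact: nbhs_pinfty_gt.
have t0 := level_gt0 p x0.
have [F FP] : exists F : I * I * 'I_(Num.truncn (c * x)) -> H,
    forall i j, i != j -> forall y, orth dot F y ->
    rnorm (A i (A j y)) <= smallness r * level p x ^+ 2 * rnorm y by near: x.
pose J : finType := (I * I * 'I_(Num.truncn (c * x)))%type.
have -> : (#|I| * #|I| * Num.truncn (c * x) = #|J|)%N.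
  by rewrite !card_prod card_ord.
apply: (eigenvalue_sum_lt dotE saA _ t0 _ FP (smallness_le _ r1) sys Sys).
- by rewrite mulr_ge0 ?sqr_ge0// ltW// smallness_gt0.
- by rewrite (ltW r0).
by near: x.
Unshelve. all: by end_near. Qed.

Lemma near_lambda_sum_ge_level (r K : R) (d : I -> R) : 0 < r < 1 ->
  (forall l, \forall n \near \oo, d l <= n.+1%:R * lam l n `^ p) ->
  K < \sum_l d l ->
  \forall x \near +oo, forall N : nat, N%:R <= K * x -> r * level p x <= Lam N.
Proof.
move=> r01 decay KS; pose m := (#|I| * (#|I| * #|I|))%N.
have [|c c0 mc] := natmul_lt_ex m (b := \sum_l d l - K).
  by rewrite subr_gt0.
have count : K + m%:R * c < \sum_l d l by rewrite addrC -ltrBrDr.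
apply: filterS2 (near_lambda_sum_ge r01 c0 decay)
  (near_sum_truncn_gt (ltW c0) count).
by move=> x ge_Lam count_x N /count_x; exact: ge_Lam.
Qed.

Lemma near_lambda_sum_lt_level (r K : R) (d : I -> R) : 0 < r < 1 ->
  (forall l, 0 < d l) ->
  (forall l, \forall n \near \oo, n.+1%:R * lam l n `^ p <= d l * r `^ p) ->
  \sum_l d l < K ->
  \forall x \near +oo, forall N : nat, K * x <= N.+1%:R -> Lam N < level p x.
Proof.
move=> r01 d0 decay SK; pose m := (#|I| * #|I|)%N; have [E Sys] := eig_sum.
have [|c c0 mc] := natmul_lt_ex m (b := K - \sum_l d l).
  by rewrite subr_gt0.
have count : \sum_l d l + m%:R * c < K by rewrite addrC -ltrBrDr.
apply: filterS2 (near_lambda_sum_lt r01 c0 d0 decay)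
  (near_sum_truncn_le (ltW c0) (fun l => ltW (d0 l)) count).
move=> x lt_x count_x N /count_x leN.
by apply: le_lt_trans lt_x; exact: (eigen_system_nonincr dotE Sys).
Qed.

Lemma near_lambda_sum_decay_ge (d : I -> R) (K : R) :
  (forall l, \forall n \near \oo, d l <= n.+1%:R * lam l n `^ p) ->
  K < \sum_l d l -> \forall n \near \oo, K <= n.+1%:R * Lam n `^ p.
Proof.
move=> decay KS; have [K0|K0] := leP K 0.
  by apply: nearW => n; apply: le_trans K0 _; rewrite mulr_ge0 ?powR_ge0.
have S0 : 0 < \sum_l d l by exact: lt_trans KS.
have [|r r01 KSr] := @powR_gt_ex _ p (K / \sum_l d l) p_gt0.
  by rewrite divr_ge0 ?(ltW K0) ?(ltW S0)//= ltr_pdivrMr// mul1r.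
have [r0 _] := andP r01; have rp0 : 0 < r `^ p by exact: powR_gt0.
have KrS : K / r `^ p < \sum_l d l by rewrite ltr_pdivrMr// mulrC -ltr_pdivrMr.
have Kr0 : 0 < (K / r `^ p)^-1 by rewrite invr_gt0 divr_gt0.
have near_Lam := near_lambda_sum_ge_level r01 decay KrS.
apply: filterS (near_pinfty_scaled_nat Kr0 near_Lam).
move=> n /(_ n); rewrite mulrCA mulfV ?gt_eqF ?divr_gt0// mulr1 ler_nat leqnSn.
set x := n.+1%:R * _ => /(_ isT) le_Lam; have x0 : 0 < x by rewrite mulr_gt0.
have t0 := level_gt0 p x0.
apply: le_trans (_ : n.+1%:R * (r * level p x) `^ p <= _).
  rewrite powRM ?(ltW r0) ?(ltW t0)// level_powR// /x le_eqVlt; apply/orP; left.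
  by apply/eqP; field; rewrite !gt_eqF.
rewrite ler_wpM2l//; apply: ge0_ler_powR; rewrite ?nnegrE ?(ltW p_gt0)//.
  by rewrite mulr_ge0 ?(ltW r0) ?(ltW t0).
by apply: le_trans le_Lam; rewrite mulr_ge0 ?(ltW r0) ?(ltW t0).
Qed.

Lemma near_lambda_sum_decay_le (d : I -> R) (K : R) :
  (forall l, 0 < d l) ->
  (forall l, \forall n \near \oo, n.+1%:R * lam l n `^ p <= d l) ->
  \sum_l d l < K -> \forall n \near \oo, n.+1%:R * Lam n `^ p <= K.
Proof.
move=> d0 decay SK.
have S0 : 0 <= \sum_l d l by apply: sumr_ge0 => l _; exact: ltW.
have K0 : 0 < K by exact: le_lt_trans SK.
have [|r r01 SKr] := @powR_gt_ex _ p ((\sum_l d l) / K) p_gt0.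
  by rewrite divr_ge0 ?(ltW K0)//= ltr_pdivrMr// mul1r.
have [r0 _] := andP r01; have rp0 : 0 < r `^ p by exact: powR_gt0.
pose d' l := d l / r `^ p; have d'0 l : 0 < d' l by exact: divr_gt0.
have S'K : \sum_l d' l < K.
  by rewrite -mulr_suml ltr_pdivrMr// mulrC -ltr_pdivrMr.
have decay' l : \forall n \near \oo, n.+1%:R * lam l n `^ p <= d' l * r `^ p.
  by apply: filterS (decay l) => n; rewrite /d' divfK ?gt_eqF.
have KV : 0 < K^-1 by rewrite invr_gt0.
have [E Sys] := eig_sum.
have near_Lam := near_lambda_sum_lt_level r01 d'0 decay' S'K.
apply: filterS (near_pinfty_scaled_nat KV near_Lam).
move=> n /(_ n); rewrite mulrCA mulfV ?gt_eqF// mulr1 lexx => /(_ isT).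
set x := n.+1%:R * _ => lt_level; have x0 : 0 < x by rewrite mulr_gt0.
apply: le_trans (_ : n.+1%:R * level p x `^ p <= _).
  rewrite ler_wpM2l//; apply: ge0_ler_powR; rewrite ?nnegrE ?(ltW p_gt0)//.
  - exact: eigen_system_ge0 Sys n.
  - exact/ltW/level_gt0.
  - exact: ltW.
by rewrite level_powR// /x invfM invrK mulrA mulfV ?mul1r.
Qed.

Lemma Delta_op_sum_le :
  (Delta p true (op_sum A) <= \sum_l Delta p true (A l))%E.
Proof.
apply: lee_sum_of_gt => [l|D K]; first exact: Delta_ge0.
move=> ltD SK; apply: limf_esup_le.
apply: near_lambda_sum_decay_le SK => l.
  by rewrite -lte_fin; apply: le_lt_trans (ltD l); exact: Delta_ge0.
by apply: filterS (limf_esup_lt (ltD l)) => n; rewrite lte_fin; exact: ltW.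
Qed.

Lemma delta_op_sum_ge :
  (\sum_l delta p true (A l) <= delta p true (op_sum A))%E.
Proof.
apply: sum_lee_of_lt => [l|d K]; first exact: delta_ge0.
move=> ltd KS; apply: limn_einf_ge.
apply: near_lambda_sum_decay_ge KS => l.
by apply: filterS (limn_einf_gt (ltd l)) => n; rewrite lte_fin; exact: ltW.
Qed.

End PositiveSpectrum.

Section Signs.
Variables (R : realType) (H : completeNormedModType R[i]).
Variable dot : {dot H for Num.conj}.
Implicit Types (A B : H -> H) (p : R) (s : bool).

Definition signed s A x := if s then A x else - A x.

Lemma Delta_signed p s A : Delta p s A = Delta p true (signed s A).
Proof. by case: s. Qed.

Lemma delta_signed p s A : delta p s A = delta p true (signed s A).
Proof. by case: s. Qed.

Lemma signed_linear s A : linear A -> linear (signed s A).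
Proof.
move=> linA a x y; rewrite /signed linA; case: s => //.
by rewrite opprD scalerN.
Qed.

Lemma signed_comp s A B : linear A -> signed s A \o signed s B = A \o B.
Proof.
move=> linA; apply/funext => x; case: s; rewrite /signed //=.
by have /= -> := raddfN (linear_pack linA) (B x); rewrite opprK.
Qed.

Lemma signed_selfadjoint s A :
  selfadjoint dot A -> selfadjoint dot (signed s A).
Proof.
by move=> saA x y; case: s; rewrite /signed /= ?linearNl ?linearNr /= saA.
Qed.

Lemma signed_seq_compact s A : seq_compact A -> seq_compact (signed s A).
Proof. by case: s => //; exact: seq_compactN. Qed.

Lemma signed_sum s (I : Type) (r : seq I) (F : I -> H -> H) :
  signed s (fun x => \sum_(i <- r) F i x) =
  fun x => \sum_(i <- r) signed s (F i) x.
Proof. by case: s; rewrite // /signed; apply/funext => x; rewrite sumrN. Qed.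

End Signs.

Theorem theorem2p3 (R : realType) (H : completeNormedModType R[i])
    (dot : {dot H for Num.conj}) (dotE : hilbert_dot dot)
    (L : nat) (A : 'I_L -> H -> H) (p : R) (p_gt0 : 0 < p)
    (Acompact : forall l, compact_op (A l))
    (Aselfadj : forall l, selfadjoint dot (A l))
    (Aorth : forall l j, l != j -> S0_class dot (p / 2) (A l \o A j))
    (s : bool) :
  let Asum := fun x => \sum_(l < L) A l x in
  [/\ (Delta p s Asum <= \sum_(l < L) Delta p s (A l))%E,
      (\sum_(l < L) delta p s (A l) <= delta p s Asum)%E
    & (forall l, Delta p s (A l) = delta p s (A l)) ->
      Delta p s Asum = delta p s Asum /\
      delta p s Asum = (\sum_(l < L) Delta p s (A l))%E].
Proof.
move=> Asum; have linA l : linear (A l) by case: (Acompact l).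
pose B l := linear_pack (signed_linear s (linA l)).
have cB l : seq_compact (B l).
  exact/signed_seq_compact/compact_op_seq_compact/Acompact.
have saB l : selfadjoint dot (B l) by exact: signed_selfadjoint.
have BS0 i j : i != j ->
    (n.+1%:R * singular_value dot (B i \o B j) n `^ (p / 2) : R)
    @[n --> \oo] --> (0 : R).
  by move=> ij; rewrite signed_comp//; case: (Aorth i j ij).
have sumB : signed s Asum = op_sum B by exact: signed_sum.
have le_Delta : (Delta p s Asum <= \sum_(l < L) Delta p s (A l))%E.
  rewrite Delta_signed sumB; under eq_bigr do rewrite Delta_signed.
  exact: (Delta_op_sum_le dotE p_gt0 cB saB BS0).
have ge_delta : (\sum_(l < L) delta p s (A l) <= delta p s Asum)%E.
  rewrite delta_signed sumB; under eq_bigr do rewrite delta_signed.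
  exact: (delta_op_sum_ge dotE p_gt0 cB saB BS0).
split=> // eqD; have le_dD : (delta p s Asum <= Delta p s Asum)%E.
  exact: limn_einf_sup.
rewrite -(eq_bigr _ (fun l _ => eqD l)) in ge_delta.
split; apply/eqP; rewrite eq_le; first by rewrite (le_trans le_Delta) ?le_dD.
by rewrite (le_trans le_dD) ?ge_delta.
Qed.
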